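(* Let $d\ge 2$ and let $\{t_e : e\in E\}$ be i.i.d. nonnegative random variables indexed by the set $E$ of undirected nearest-neighbour edges of $\mathbb{Z}^d$. Assume that for some positive $M_0<\infty$ there is a positive increasing function $f$ on $(0,\infty)$ so that $$\log P(t_e>x)=-x^d f(x),\qquad x>M_0 .$$ Then for every sufficiently small $\varepsilon>0$, $$\limsup_{n\to\infty}\frac{1}{n^d}\log P\big(a_n\ge(\nu+\varepsilon)n\big)<0$$ if and only if $$\sum_{n=1}^{\infty}\frac{1}{f(2^n)^{1/(d-1)}}<\infty .$$
   Context: $\log$ denotes the logarithm to base 2. This is standard first passage percolation on $\mathbb{Z}^d$. Let $\Psi_n$ be the set of nearest-neighbour paths of finite length in $\mathbb{Z}^d$ starting at $0$ and ending at $(n,0,\dots,0)$. Write $e\in\gamma$ if the edge $e$ is traversed by $\gamma$, and set $a_n=\inf_{\gamma\in\Psi_n}\sum_{e\in\gamma}t_e$. The constant $\nu\ge 0$ is the nonrandom almost sure limit $\nu=\lim_{n\to\infty}a_n/n$. *)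

(* Defs.v *)
From mathcomp Require Import all_boot all_order all_algebra.
From mathcomp Require Import finmap zify.
From mathcomp Require Import all_classical all_reals all_analysis.

Set Implicit Arguments.
Unset Strict Implicit.
Unset Printing Implicit Defensive.

Import Order.TTheory GRing.Theory Num.Theory.
Import numFieldNormedType.Exports.

Local Open Scope classical_set_scope.
Local Open Scope ring_scope.

(* The pair (x, i) stands for the undirected edge {x, x + e_i}; each undirected
   nearest-neighbour edge of Z^d has exactly one such representative
   (see [adj_joinsP] and [joins_inj]). *)
Definition edge (d : nat) : Type := ('rV[int]_d * 'I_d)%type.

Definition adj (d : nat) (x y : 'rV[int]_d) : bool :=
  \sum_(i < d) `|x ord0 i - y ord0 i| == 1.

Definition joins (d : nat) (e : edge d) (x y : 'rV[int]_d) : bool :=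
  let z := e.1 + delta_mx ord0 e.2 in
  ((x == e.1) && (y == z)) || ((x == z) && (y == e.1)).

Definition axis_point (d n : nat) : 'rV[int]_d :=
  \row_(i < d) (if val i == 0%N then n%:Z else 0).

(* Membership in Psi_n; the list p holds the vertices of the path after its start at 0. *)
Definition fpp_path (d n : nat) (p : seq 'rV[int]_d) : bool :=
  path (@adj d) 0 p && (last 0 p == axis_point d n).

Definition traversed (d : nat) (p : seq 'rV[int]_d) : set (edge d) :=
  [set e | has (fun u => joins e u.1 u.2) (zip (0 :: p) p)].

(* The sum ranges over the set of traversed edges, so that an edge crossed
   several times is counted once; see [finite_traversed] for its finiteness. *)
Definition passage_time (R : realType) (T : Type) (d : nat)
    (t : edge d -> T -> R) (p : seq 'rV[int]_d) (w : T) : R :=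
  \sum_(e \in traversed p) t e w.

Definition fpp (R : realType) (T : Type) (d : nat)
    (t : edge d -> T -> R) (n : nat) (w : T) : R :=
  inf [set passage_time t p w | p in [set p | fpp_path n p]].

Definition mutually_independent (R : realType) (disp : measure_display)
    (T : measurableType disp) (P : probability T R) (I : choiceType)
    (X : I -> {RV P >-> R}) : Prop :=
  forall (J : {fset I}) (B : I -> set R),
    (forall i, measurable (B i)) ->
    P (\bigcap_(i in [set` J]) (X i @^-1` B i)) =
    (\prod_(i <- J) P (X i @^-1` B i))%E.

Definition identically_distributed (R : realType) (disp : measure_display)
    (T : measurableType disp) (P : probability T R) (I : Type)
    (X : I -> {RV P >-> R}) : Prop :=
  forall (i j : I) (B : set R), measurable B ->
    distribution P (X i) B = distribution P (X j) B.

(* Logarithm to base 2, with log2e 0 = -oo. *)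
Definition log2e (R : realType) (x : \bar R) : \bar R :=
  (lne x * ((ln 2)^-1)%:E)%E.

Section sanity.
Variable d : nat.
Implicit Types (x y : 'rV[int]_d) (e : edge d).

Lemma delta_row_neq0 (i : 'I_d) : delta_mx ord0 i != 0 :> 'rV[int]_d.
Proof. by apply/eqP => /rowP /(_ i); rewrite !mxE !eqxx. Qed.

Lemma delta_row_inj (i j : 'I_d) :
  delta_mx ord0 i = delta_mx ord0 j :> 'rV[int]_d -> i = j.
Proof. by move=> /rowP /(_ i); rewrite !mxE !eqxx /=; case: eqP. Qed.

Lemma deltaD_row_neq0 (i j : 'I_d) :
  delta_mx ord0 i + delta_mx ord0 j != 0 :> 'rV[int]_d.
Proof. by apply/eqP => /rowP /(_ i); rewrite !mxE !eqxx /=; case: (_ == _). Qed.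

Lemma joins_sym e x y : joins e x y = joins e y x.
Proof. by rewrite /joins orbC; congr orb; rewrite andbC. Qed.

Lemma joins_inj e e' x y : joins e x y -> joins e' x y -> e = e'.
Proof.
have aux (f f' : edge d) u v : u = f.1 -> v = f.1 + delta_mx ord0 f.2 ->
    joins f' u v -> f = f'.
  case: f f' => [a i] [b j] /= -> -> /orP[] /andP[/= /eqP ha /eqP hb].
    by move: hb; rewrite ha => /addrI /(@delta_row_inj i j) ->.
  move: hb; rewrite ha -addrA -[in RHS](addr0 b) => /addrI /eqP.
  by rewrite (negPf (deltaD_row_neq0 _ _)).
move=> /orP[] /andP[/eqP h1 /eqP h2]; first exact: aux h1 h2.
by rewrite joins_sym; exact: aux h2 h1.
Qed.

Lemma adj_joinsP x y : reflect (exists e, joins e x y) (adj x y).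
Proof.
apply: (iffP idP) => [h|].
  have [i hi] : exists i, x ord0 i - y ord0 i != 0.
    apply/existsP; rewrite -[X in is_true X]negbK; apply/negP => /existsPn h0.
    by move: h; rewrite /adj big1 // => i _; rewrite (eqP (negbNE (h0 i))) normr0.
  move: h; rewrite /adj (bigD1 i) //=.
  set S := \sum_(_ < _ | _) _ => /eqP hS.
  have S0 : 0 <= S by apply: sumr_ge0.
  have h1 : 1 <= `|x ord0 i - y ord0 i| by rewrite -gtz0_ge1 normr_gt0.
  have [hi1 hS0] : `|x ord0 i - y ord0 i| = 1 /\ S = 0.
    by move: S0 h1 hS; lia.
  have hj j : j != i -> x ord0 j = y ord0 j.
    move=> ji; apply/eqP; rewrite -subr_eq0 -normr_eq0.
    move/eqP: hS0; rewrite psumr_eq0 // => /allP /(_ j).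
    by rewrite mem_index_enum ji => /(_ isT).
  have [hxy|hxy] : y ord0 i = x ord0 i + 1 \/ x ord0 i = y ord0 i + 1 by lia.
    exists (x, i); apply/orP; left; rewrite eqxx /=; apply/eqP/rowP => j.
    rewrite !mxE eqxx /=; have [->|ji] := eqVneq j i; first by rewrite hxy.
    by rewrite addr0 hj.
  exists (y, i); apply/orP; right; rewrite eqxx andbT /=; apply/eqP/rowP => j.
  rewrite !mxE eqxx /=; have [->|ji] := eqVneq j i; first by rewrite hxy.
  by rewrite addr0 hj.
have key (i : 'I_d) :
    \sum_(k < d) `|(delta_mx ord0 i : 'rV[int]_d) ord0 k| = 1.
  rewrite (bigD1 i) //= mxE !eqxx big1 ?addr0 // => j ji.
  by rewrite mxE (negPf ji) andbF normr0.
case=> -[a i] /orP[] /andP[/= /eqP -> /eqP ->]; rewrite /adj; apply/eqP.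
  rewrite -[RHS](key i); apply: eq_bigr => k _.
  by rewrite [in LHS]mxE opprD addrA subrr sub0r normrN.
rewrite -[RHS](key i); apply: eq_bigr => k _.
by rewrite [in LHS]mxE addrAC subrr add0r.
Qed.

Lemma finite_traversed (p : seq 'rV[int]_d) : finite_set (traversed p).
Proof.
rewrite /traversed; elim: (zip _ _) => [|u s IHs] /=.
  by apply: (@sub_finite_set _ _ set0).
apply: (@sub_finite_set _ _ ([set e | joins e u.1 u.2] `|`
                             [set e | has (fun v => joins e v.1 v.2) s])).
  by move=> e /orP[]; [left|right].
rewrite finite_setU; split => //.
have [[e0 h0]|hn] := pselect (exists e, joins e u.1 u.2).
  apply: (@sub_finite_set _ _ [set e0]); last exact: finite_set1.
  by move=> e /= he; apply: joins_inj he h0.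
by apply: (@sub_finite_set _ _ set0) => // e he; case: hn; exists e.
Qed.

End sanity.

(* Main.v *)
(* Divergence of the series forces a large passage time by a barrier around the
   origin: all edges at distance about 2^k receive weight at least
   x_k ~ n 2^-k f(n 2^-k)^(-1/(d-1)), normalised by the partial sum of the series.
   Crossing the barrier costs more than (nu + eps) n, while the logarithm of its
   probability is o(n^d), because the partial sums diverge.

   Conversely, a_n is bounded by the average, over about n^(d-1) parallel tubes, of
   the cost of reaching the tube from the origin along a discretised ray, of crossing
   the tube, and of returning along a reflected ray.
   An edge at distance j from the apex carries a fraction O(j^-(d-1)) of the rays, so
   the average ray cost is a weighted sum of independent weights, and Chernoff's bound
   at inverse temperature of order n^(d-1) leaves the exponent
   sum_k 2^-(kd) log E exp(2^(k(d-1)) t_e), whose tail is small exactly when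
   the series converges.
   The tubes are cut into translates of one finite block whose passage time is close
   to nu times its length; these are independent up to finitely many residue classes,
   so their average deviates with probability exponentially small in n^d. *)

Require Import Defs.
From mathcomp Require Import all_boot all_order all_algebra.
From mathcomp Require Import finmap zify ring lra.
From mathcomp Require Import all_classical all_reals all_analysis measurable_realfun.

Set Implicit Arguments.
Unset Strict Implicit.
Unset Printing Implicit Defensive.

Import Order.TTheory GRing.Theory Num.Theory.
Import numFieldNormedType.Exports.

Local Open Scope classical_set_scope.
Local Open Scope ring_scope.

(** * Random fields on configuration space *)

(** Write d = d' + 1. Both directions rest on one optimisation. Maximising s x - x^d f(x) at s =
    2^(k d') puts x near 2^k f^(-1/d') and gives the value 2^(kd) f^(-1/d'); this is the logarithmic
    moment of an edge seen at scale k. Dually, the cheapest barrier with prescribed total sum of 2^k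
    x_k and energy sum of 2^(kd) x_k^d f(x_k) has x_k proportional to 2^-k f^(-1/d'). Hence the
    exponent 1/(d-1) on both sides. The obstacle is that the optimiser is the argument of [f]
    itself, whose growth is arbitrary; only monotonicity is available, so [f] is evaluated at a
    comparable or much smaller power of two. Averaging over routes replaces an infimum by a linear
    functional of the weights. The rays have length at most n 2^-k0, so that only scales k >= k0
    occur and the tail of the series appears instead of its sum. The three legs of a route may share
    edges; they are combined by a union bound. Independence and equality in law are transferred once
    and for all to functions of the whole configuration, because passage times and blocks depend on
    many edges at a time. *)

Section configurations.
Variables (R : realType) (I : choiceType).

Definition fcyl (A : set I) : set (set (I -> R)) :=
  [set C | exists2 J : {fset I}, [set` J] `<=` A &
     exists2 B : I -> set R, (forall i, measurable (B i)) &
       C = \bigcap_(i in [set` J]) [set u | B i (u i)]].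

(** The carrier is always the set of all configurations; only the sigma-algebra depends on [A].
    Events seen through different coordinate sets can thus be intersected directly. *)
Definition cfg (A : set I) := g_sigma_algebraType (fcyl A).

Lemma fcylI A : setI_closed (fcyl A).
Proof.
move=> _ _ [J JA [B mB ->]] [J' JA' [B' mB' ->]].
exists (J `|` J')%fset.
  by move=> i /=; rewrite inE => /orP[/JA|/JA'].
exists (fun i => (if i \in J then B i else setT) `&`
                 (if i \in J' then B' i else setT)).
  by move=> i; apply: measurableI; case: ifP.
apply/seteqP; split=> [u [h h'] i /= _|u h].
  by split; case: ifPn => // iJ; [exact: h|exact: h'].
split=> i /= iJ; have := h i; rewrite /= in_fsetU iJ ?orbT => /(_ isT) [].
  by [].
by [].
Qed.

Lemma fcylT A : fcyl A setT.
Proof.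
exists fset0; first by move=> i; rewrite /= inE.
exists (fun=> setT) => //.
by apply/esym; rewrite -subTset => u _ i.
Qed.

Lemma measurable_coord (A : set I) i :
  A i -> measurable_fun [set: cfg A] (fun u : cfg A => u i).
Proof.
move=> Ai _ B mB; rewrite setTI; apply: sub_sigma_algebra.
exists [fset i]%fset; first by move=> j; rewrite /= inE => /eqP ->.
exists (fun=> B) => //.
apply/seteqP; split=> [u h j|u h]; first by rewrite /= inE => /eqP ->.
by apply: (h i); rewrite /= inE.
Qed.

Lemma measurable_into_cfg (A : set I) d (T : measurableType d)
    (g : T -> I -> R) :
  (forall i, A i -> measurable_fun setT (g ^~ i)) ->
  measurable_fun setT (g : T -> cfg A).
Proof.
move=> mg; apply: (@measurability _ _ T (cfg A) setT g (fcyl A)) => //.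
move=> _ [_ [J JA [B mB ->]] <-]; rewrite setTI preimage_bigcap.
apply: fin_bigcap_measurable => //= i iJ.
by rewrite -[X in measurable X]setTI; apply: (mg i (JA _ iJ)).
Qed.

Definition depends_on (S : Type) (A : set I) (phi : (I -> R) -> S) :=
  forall u v, (forall i, A i -> u i = v i) -> phi u = phi v.

(** Such a function is unchanged by composition with the map that sets the coordinates outside [A]
    to 0, and that map is measurable from [cfg A]. *)
Lemma depends_on_measurable d (S : measurableType d) (A : set I)
    (phi : (I -> R) -> S) :
  depends_on A phi -> measurable_fun [set: cfg setT] phi ->
  measurable_fun [set: cfg A] phi.
Proof.
move=> dphi mphi.
pose r (u : I -> R) := fun i => if i \in A then u i else 0.
have mr : measurable_fun [set: cfg A] (r : cfg A -> cfg setT).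
  apply: measurable_into_cfg => i _; rewrite /r.
  case: (boolP (i \in A)) => [iA|_]; last exact: measurable_cst.
  by apply: measurable_coord; exact/set_mem.
have -> : phi = phi \o r.
  by apply/funext => u; apply: dphi => i Ai; rewrite /r mem_set.
apply: (@measurableT_comp _ _ _ (cfg A) (cfg [set: I]) S phi) => //.
Qed.

End configurations.

Section random_field.
Context (R : realType) (I : choiceType) (disp : measure_display)
  (T : measurableType disp) (P : probability T R).
Variable X : I -> {RV P >-> R}.

Definition field (tau : I -> I) (w : T) : I -> R := fun i => X (tau i) w.

Lemma measurable_field A tau :
  measurable_fun setT (field tau : T -> cfg R A).
Proof. by apply: measurable_into_cfg => i _; exact: measurable_funP. Qed.

Hypotheses (X_indep : mutually_independent X)
  (X_ident : identically_distributed X).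

Lemma cylinder_prob (tau : I -> I) (tau_inj : injective tau)
    (J : {fset I}) (B : I -> set R) : (forall i, measurable (B i)) ->
  P (field tau @^-1` \bigcap_(i in [set` J]) [set u | B i (u i)]) =
  (\prod_(i <- J) P (X i @^-1` B i))%E.
Proof.
move=> mB.
(* The constraint at an index of the image is written as an intersection over its preimages, a
   single one by injectivity, so that no inverse of [tau] has to be chosen. *)
have hB' j : measurable (if j \in [fset tau i | i in J]%fset
    then (\bigcap_(i in [set i | i \in J /\ tau i = j]) B i) else setT).
  case: ifPn => // /imfsetP [i /= iJ ->].
  suff -> : [set k | k \in J /\ tau k = tau i] = [set i].
    by rewrite bigcap_set1.
  apply/seteqP; split=> k /=; first by move=> [_ /tau_inj].
  by move=> ->.
have := X_indep [fset tau i | i in J]%fset hB'.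
rewrite big_imfset /=; last by move=> ? ? _ _; exact: tau_inj.
have E i : i \in J -> (if tau i \in [fset tau i | i in J]%fset
    then (\bigcap_(k in [set k | k \in J /\ tau k = tau i]) B k) else setT) = B i.
  move=> iJ; rewrite in_imfset //.
  suff -> : [set k | k \in J /\ tau k = tau i] = [set i].
    by rewrite bigcap_set1.
  apply/seteqP; split=> k /=; first by move=> [_ /tau_inj].
  by move=> ->.
move=> h.
transitivity (\prod_(i <- J) P (X (tau i) @^-1` B i))%E; last first.
  by apply: eq_bigr => i _; exact: X_ident.
rewrite [RHS]big_seq [RHS](eq_bigr (fun i => P (X (tau i) @^-1` (if tau i \in [fset tau i | i in J]%fset
    then (\bigcap_(k in [set k | k \in J /\ tau k = tau i]) B k) else setT)))).
  rewrite -big_seq -h; congr (P _).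
  apply/seteqP; split=> [w hw j /= /imfsetP [i /= iJ ->]|w hw i /= iJ].
    by rewrite /= in_imfset// => k [kJ /tau_inj ->]; exact: hw.
  have := hw (tau i); rewrite /= in_imfset// => /(_ isT) /(_ i); exact.
by move=> i iJ; rewrite E.
Qed.

(** Cylinders are stable under intersection and generate; the two image measures agree on them. *)
Lemma field_law (tau : I -> I) : injective tau ->
  forall D : set (cfg R [set: I]), measurable D ->
  P (field tau @^-1` D) = P (field id @^-1` D).
Proof.
move=> tau_inj D mD.
have pf s := @measurable_field setT s.
pose m1 : {measure set (cfg R [set: I]) -> \bar R} :=
  measure_function_pushforward__canonical__measure_function_Measure P (pf tau).
pose m2 : {measure set (cfg R [set: I]) -> \bar R} :=
  measure_function_pushforward__canonical__measure_function_Measure P (pf id).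
change (m1 D = m2 D).
apply: (@measure_unique _ R (cfg R [set: I]) (fcyl setT) (fun=> setT) _ _ _ _ m1 m2) => //.
- exact: fcylI.
- by move=> _; exact: fcylT.
- by apply: bigcup_const; exists 0%N.
- move=> _ [J _ [B mB ->]]; rewrite /m1 /m2 /= /pushforward.
  by rewrite !cylinder_prob.
- by move=> _; rewrite /m1 /= /pushforward preimage_setT probability_setT ltry.
Qed.

Lemma field_indep (A B : set I) (D E : set (I -> R)) :
  A `&` B = set0 ->
  measurable (D : set (cfg R A)) -> measurable (E : set (cfg R B)) ->
  P (field id @^-1` (D `&` E)) = (P (field id @^-1` D) * P (field id @^-1` E))%E.
Proof.
move=> AB mD mE.
have pf C := @measurable_field C id.
have mpre C (F : set (cfg R C)) : measurable F -> measurable (field id @^-1` F).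
  by move=> mF; rewrite -[X in measurable X]setTI; exact: (pf C measurableT F mF).
(* With one event [F] fixed, both sides are finite measures in [D'], so factorisation extends from
   cylinders. It is applied twice, once for each event. *)
have ext C (F : set T) : measurable F ->
    (forall D', fcyl C D' -> P (field id @^-1` D' `&` F) = (P F * P (field id @^-1` D'))%E) ->
    forall D', measurable (D' : set (cfg R C)) ->
      P (field id @^-1` D' `&` F) = (P F * P (field id @^-1` D'))%E.
  move=> mF hF D' mD'.
  pose m1 : {measure set (cfg R C) -> \bar R} :=
    measure_function_pushforward__canonical__measure_function_Measure
      (mrestr P mF) (pf C).
  have PF0 : 0 <= fine (P F) by apply: fine_ge0.
  pose m2 : {measure set (cfg R C) -> \bar R} :=
    mscale (NngNum PF0)
    (measure_function_pushforward__canonical__measure_function_Measure P (pf C)).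
  have PF : (fine (P F))%:E = P F by rewrite fineK// fin_num_measure.
  rewrite -PF; change (m1 D' = m2 D').
  apply: (@measure_unique _ R (cfg R C) (fcyl C) (fun=> setT) _ _ _ _ m1 m2) => //.
  - exact: fcylI.
  - by move=> _; exact: fcylT.
  - by apply: bigcup_const; exists 0%N.
  - by move=> A' /hF h; rewrite /m1 /m2 /= /pushforward /mrestr /mscale /= PF.
  - move=> _; rewrite /m1 /= /pushforward preimage_setT /mrestr setTI.
    by rewrite -PF ltry.
rewrite preimage_setI muleC; apply: (ext A) => //; first exact: mpre mE.
move=> D' cD'; rewrite setIC muleC; apply: (ext B) => //.
  by apply: (mpre A); apply: sub_sigma_algebra.
case: cD' => J JA [BJ mBJ ->] _ [J' JB [BJ' mBJ' ->]].
rewrite -preimage_setI.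
(* The index sets are disjoint, so the two cylinders merge into one without conflicting
   constraints. *)
pose B'' i := if i \in J then BJ i else BJ' i.
have -> : \bigcap_(i in [set` J']) [set u : I -> R | BJ' i (u i)] `&`
    \bigcap_(i in [set` J]) [set u | BJ i (u i)] =
    \bigcap_(i in [set` (J `|` J')%fset]) [set u | B'' i (u i)].
  apply/seteqP; split=> [u [h' h] i /=|u h].
    by rewrite in_fsetU /B'' => iJ; case: ifPn iJ => [iJ _|_ /= iJ]; [exact: h|exact: h'].
  split=> i /= iJ; have := h i; rewrite /= in_fsetU iJ ?orbT /B'' => /(_ isT); last by rewrite iJ.
  case: ifPn => // iJ'; suff : set0 i by [].
  by rewrite -AB; split; [exact: JA|exact: JB].
have disjJ i : i \in J -> i \in J' -> False.
  by move=> /JA iA /JB iB; have : (A `&` B) i by []; rewrite AB.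
rewrite !cylinder_prob //; last by move=> i; rewrite /B''; case: ifP.
rewrite (big_fsetID _ (fun i => i \in J)) /=; congr (_ * _)%E.
  apply: eq_fbig => [i|i]; rewrite !inE /=.
    by case: (i \in J); case: (i \in J').
  by move=> /andP[_ iJ]; rewrite /B'' iJ.
apply: eq_fbig => [i|i]; rewrite !inE /=.
  by have := disjJ i; case: (i \in J); case: (i \in J') => //= /(_ isT isT).
by move=> /andP[_ iJ]; rewrite /B'' (negPf iJ).
Qed.

(** By [field_indep] the joint law of the two values is the product law; Tonelli then factors the
    integral. *)
Lemma expectation_mul (A B : set I) (phi psi : (I -> R) -> R) :
  A `&` B = set0 ->
  measurable_fun [set: cfg R [set: I]] phi -> measurable_fun [set: cfg R [set: I]] psi ->
  depends_on A phi -> depends_on B psi ->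
  (forall u, 0 <= phi u) -> (forall u, 0 <= psi u) ->
  (\int[P]_w (phi (field id w) * psi (field id w))%:E =
   \int[P]_w (phi (field id w))%:E * \int[P]_w (psi (field id w))%:E)%E.
Proof.
move=> AB mphi mpsi dphi dpsi phi0 psi0.
have mf C := @measurable_field C id.
have mphiA := depends_on_measurable dphi mphi.
have mpsiB := depends_on_measurable dpsi mpsi.
have mX1 : measurable_fun setT (phi \o field id).
  by apply: (@measurableT_comp _ _ _ _ (cfg R [set: I])) => //; exact: mf.
have mX2 : measurable_fun setT (psi \o field id).
  by apply: (@measurableT_comp _ _ _ _ (cfg R [set: I])) => //; exact: mf.
pose Z w := ((phi \o field id) w, (psi \o field id) w).
have mZ : measurable_fun setT Z by exact: measurable_fun_pair.
pose X1 : {RV P >-> R} := mfun_Sub (mem_set mX1).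
pose X2 : {RV P >-> R} := mfun_Sub (mem_set mX2).
pose Q : {measure set (R * R) -> \bar R} :=
  measure_function_pushforward__canonical__measure_function_Measure P mZ.
have QE : forall S, measurable S -> (distribution P X1 \x distribution P X2)%E S = Q S.
  apply: product_measure_unique => U V mU mV.
  have := @field_indep A B (phi @^-1` U) (psi @^-1` V) AB.
  apply; rewrite -[X in measurable X]setTI.
    exact: mphiA.
  exact: mpsiB.
(* The absolute values make the integrand nonnegative on the whole plane and change nothing on the
   range of the two functions. *)
pose g := fun z : R * R => (`|z.1| * `|z.2| : R)%:E.
have mg : measurable_fun [set: (R * R)%type] g.
  apply/measurable_EFinP; apply: measurable_funM => /=.
    by apply: measurableT_comp => //; exact: measurable_fst.
  by apply: measurableT_comp => //; exact: measurable_snd.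
have mn : measurable_fun [set: R] (fun x => (`|x| : R)%:E).
  by apply/measurable_EFinP; exact: normr_measurable.
have marg (Y : {RV P >-> R}) : (forall w, 0 <= Y w) ->
    (\int[distribution P Y]_x `|x|%:E = \int[P]_w (Y w)%:E)%E.
  move=> Y0; rewrite ge0_integral_distribution//.
  by apply: eq_integral => w _ /=; rewrite ger0_norm.
transitivity (\int[Q]_z g z)%E.
  rewrite ge0_integral_pushforward//.
    by apply: eq_integral => w _ /=; rewrite /g /= !ger0_norm.
  by move=> z _; rewrite lee_fin mulr_ge0.
rewrite (eq_measure_integral (distribution P X1 \x distribution P X2)%E); last first.
  by move=> S mS _; exact/esym/QE.
rewrite fubini_tonelli1//; last by move=> z; rewrite lee_fin mulr_ge0.
have -> : (\int[P]_w (phi (field id w))%:E =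
  \int[distribution P X1]_x `|x|%:E)%E by rewrite marg// => w; exact: phi0.
have -> : (\int[P]_w (psi (field id w))%:E =
  \int[distribution P X2]_x `|x|%:E)%E by rewrite marg// => w; exact: psi0.
under eq_integral do rewrite /fubini_F.
rewrite -ge0_integralZr//; last by apply: integral_ge0 => x _; rewrite lee_fin.
apply: eq_integral => x _; rewrite /g /=.
under eq_integral do rewrite EFinM.
by rewrite ge0_integralZl// => y _; rewrite lee_fin.
Qed.

Lemma expectation_prod (K : eqType) (r : seq K) (A : K -> set I)
    (phi : K -> (I -> R) -> R) : uniq r ->
  (forall k k', k \in r -> k' \in r -> k != k' -> A k `&` A k' = set0) ->
  (forall k, measurable_fun [set: cfg R [set: I]] (phi k)) ->
  (forall k, depends_on (A k) (phi k)) ->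
  (forall k u, 0 <= phi k u) ->
  (\int[P]_w (\prod_(k <- r) phi k (field id w))%:E =
   \prod_(k <- r) \int[P]_w (phi k (field id w))%:E)%E.
Proof.
move=> + + mphi dphi phi0.
elim: r => [_ _|k r IH /= /andP[kr ur] disj].
  under eq_integral do rewrite big_nil.
  rewrite big_nil integral_cst//. rewrite mul1e; exact: probability_setT.
under eq_integral do rewrite big_cons.
pose psi u := \prod_(j <- r) phi j u.
rewrite big_cons -IH//; last first.
  by move=> i j ir jr; apply: disj; rewrite inE ?ir ?jr orbT.
apply: (@expectation_mul (A k) (\bigcup_(j in [set` r]) A j) (phi k) psi) => //.
- rewrite -subset0 => i [Aki [j jr Aji]].
  have <- : A k `&` A j = set0; last by [].
  apply: disj; first by rewrite inE eqxx.
    by move: jr; rewrite inE /= => ->; rewrite orbT.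
  by apply: contraNneq kr => ->.
- by apply: measurable_prod => j _.
- move=> u v uv; apply: eq_big_seq => j jr; apply: dphi => i Aji.
  by apply: uv; exists j.
- by move=> u; exact: prodr_ge0.
Qed.
End random_field.

(** * Moment generating function of an edge weight *)

Section summable_tails.
Variable R : realType.
Implicit Types u v : nat -> R.

(** For nonnegative [u] this is convergence of the series, stated with finite sums only, as they
    arise in the ray estimate. *)
Definition summable_tail u := forall eta : R, 0 < eta ->
  exists j0 : nat, forall J : nat, \sum_(j0 <= j < J) u j <= eta.

Lemma summable_tail_eseries u : (forall n, 0 <= u n) ->
  (\sum_(1 <= n <oo) (u n)%:E < +oo)%E -> summable_tail u.
Proof.
move=> u0 hu eta eta0.
have hu0 : (\sum_(0 <= n <oo) (u n)%:E < +oo)%E.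
  rewrite nneseries_recl//; last by move=> n _; rewrite lee_fin.
  by rewrite lte_add_pinfty// ltry.
have := @nneseries_tail_cvg R (fun n => (u n)%:E) xpredT hu0.
have u0' k : xpredT k -> (0 <= (u k)%:E)%E by rewrite lee_fin.
move=> /(_ u0') /fine_cvgP[_ /cvgrPdist_lt /(_ _ eta0)] [j0 _ hj].
have hfin : (\sum_(j0 <= k <oo) (u k)%:E)%E \is a fin_num.
  rewrite ge0_fin_numE; last by apply: nneseries_ge0 => n _ _; rewrite lee_fin.
  apply: le_lt_trans hu0.
  have := @nneseries_split R (fun n => (u n)%:E) 0 j0 (fun k _ => u0' k isT).
  rewrite add0n => ->; rewrite leeDr// sume_ge0// => i _; exact: u0'.
exists j0 => J.
have := hj j0 (leqnn _); rewrite /= sub0r normrN => h.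
rewrite -lee_fin -sumEFin.
apply: (le_trans (nneseries_lim_ge J _)); first by move=> n _ _; exact: u0'.
rewrite -(fineK hfin) lee_fin.
by apply: (le_trans (ler_norm _)); exact: ltW.
Qed.

Lemma summable_tailD u v : summable_tail u -> summable_tail v ->
  (forall n, 0 <= u n) -> (forall n, 0 <= v n) ->
  summable_tail (fun n => u n + v n).
Proof.
move=> hu hv u0 v0 eta eta0.
have e2 : 0 < eta / 2 by rewrite divr_gt0.
have [j1 h1] := hu _ e2; have [j2 h2] := hv _ e2.
exists (maxn j1 j2) => J; rewrite big_split /= (splitr eta).
have aux (w : nat -> R) j : (forall n, 0 <= w n) -> (j <= maxn j1 j2)%N ->
    \sum_(maxn j1 j2 <= i < J) w i <= \sum_(j <= i < J) w i.
  move=> w0 jm; have [mJ|Jm] := leqP (maxn j1 j2) J.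
    by rewrite (@big_cat_nat _ _ _ (maxn j1 j2) j J)//= lerDr sumr_ge0.
  by rewrite big_geq ?(ltnW Jm)// sumr_ge0.
apply: lerD.
  by apply: le_trans (h1 J); apply: aux => //; exact: leq_maxl.
by apply: le_trans (h2 J); apply: aux => //; exact: leq_maxr.
Qed.

Lemma summable_tailZ u (c : R) : 0 <= c -> summable_tail u ->
  summable_tail (fun n => c * u n).
Proof.
move=> c0 hu eta eta0.
have c1 : 0 < c + 1 by rewrite ltr_wpDl.
have [j0 h] := hu (eta / (c + 1)) (divr_gt0 eta0 c1).
exists j0 => J; rewrite -mulr_sumr.
apply: (le_trans (ler_wpM2l c0 (h J))).
by rewrite mulrCA ler_piMr ?(ltW eta0)// ler_pdivrMr// mul1r lerDl.
Qed.

(** Halving the index repeats each term twice. It is needed because [f] will be evaluated at 2^(k/2)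
    instead of 2^k. *)
Lemma summable_tail_half u : (forall n, 0 <= u n) -> summable_tail u ->
  summable_tail (fun n => u n./2).
Proof.
move=> u0 hu eta eta0.
have [j0 h] := hu (eta / 2) ltac:(by rewrite divr_gt0).
exists j0.*2 => J.
have key m : \sum_(j0.*2 <= i < m.*2) u i./2 = 2 * \sum_(j0 <= i < m) u i.
  elim: m => [|m IH]; first by rewrite !big_geq ?mulr0.
  have [mj|jm] := ltnP m j0.
    by rewrite !big_geq ?mulr0// leq_double.
  rewrite doubleS big_nat_recr/=; last by rewrite leqW// leq_double.
  rewrite big_nat_recr/=; last by rewrite leq_double.
  rewrite [in RHS]big_nat_recr//=.
  by rewrite IH uphalf_double doubleK; ring.
apply: (@le_trans _ _ (\sum_(j0.*2 <= i < J.*2) u i./2)).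
  have [jJ|Jj] := leqP j0.*2 J.
    by rewrite (@big_cat_nat _ _ _ J j0.*2 J.*2)//= ?lerDl ?sumr_ge0// -addnn leq_addr.
  by rewrite big_geq ?(ltnW Jj)// sumr_ge0.
by rewrite key; have := h J; lra.
Qed.

Lemma summable_tail_geometric (q : R) : 0 < q < 1 -> summable_tail (fun n => q ^+ n).
Proof.
move=> /andP[q0 q1]; apply: summable_tail_eseries => [n|].
  by rewrite exprn_ge0// ltW.
apply: (@le_lt_trans _ _ (1 * (1 - q)^-1)%:E); last exact: ltry.
apply: lime_le.
  by apply: is_cvg_nneseries => i _ _; rewrite lee_fin exprn_ge0// ltW.
apply: nearW => n; rewrite sumEFin lee_fin.
apply: le_trans (@geometric_le_lim R n 1 q _ _ _); rewrite ?ler01 ?gtr0_norm//.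
rewrite /series /=; case: n => [|n]; first by rewrite !big_geq.
rewrite [leRHS](eq_bigr (fun i => q ^+ i)); last by move=> i _; rewrite /= mul1r.
by rewrite [leRHS]big_ltn//= lerDr exprn_ge0// ltW.
Qed.

End summable_tails.

Lemma half_le_ln2 (R : realType) : 2^-1 <= ln 2 :> R.
Proof.
have := @le_ln1Dx R (- 2^-1) ltac:(lra).
have -> : 1 - 2^-1 = 2^-1 :> R by lra.
rewrite lnV ?posrE//; lra.
Qed.

Lemma archi_pow2 (R : realType) (a y : R) : 0 < a -> exists k, y <= 2 ^+ k * a.
Proof.
move=> a0; exists (Num.bound `|y / a|).
rewrite -ler_pdivrMr//.
apply: (le_trans (ler_norm _)); apply: (le_trans (ltW (archi_boundP (normr_ge0 _)))).
by rewrite -natrX ler_nat ltnW// ltn_expl.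
Qed.

Section moment_generating.
Context (R : realType) (disp : measure_display) (T : measurableType disp)
  (P : probability T R) (Y : {RV P >-> R}) (d' : nat) (M0 : R) (f : R -> R).
Hypotheses (Y_ge0 : forall w, 0 <= Y w) (M0_gt0 : 0 < M0)
  (f_gt0 : forall x : R, 0 < x -> 0 < f x)
  (f_incr : forall x y : R, 0 < x -> x <= y -> f x <= f y)
  (tail : forall x : R, M0 < x ->
     P [set w | x < Y w] = (expR (- (ln 2 * (x ^+ d'.+1 * f x))))%:E).

(** If y lies in the shell from 2^i a to 2^(i+1) a, the term of index i alone dominates; otherwise y
    <= a. *)
Lemma expR_dyadic_bound (s a y : R) : 0 <= s -> 0 < a -> 0 <= y ->
  ((expR (s * y))%:E <= (expR (s * a))%:E +
   \sum_(i <oo) (expR (s * (2 ^+ i.+1 * a)) * (2 ^+ i * a < y)%R%:R)%:E)%E.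
Proof.
move=> s0 a0 y0.
have t0 i : (0 <= (expR (s * (2 ^+ i.+1 * a)) * (2 ^+ i * a < y)%R%:R)%:E)%E.
  by rewrite lee_fin mulr_ge0 ?expR_ge0.
have [ya|ay] := leP y a.
  apply: (le_trans (y := (expR (s * a))%:E)).
    by rewrite lee_fin ler_expR ler_wpM2l.
  by rewrite leeDl// nneseries_ge0.
have ex : exists k, y <= 2 ^+ k * a by exact: archi_pow2.
case: (ex_minnP ex) => -[|i] yi imin.
  by move: yi; rewrite expr0 mul1r leNgt ay.
have iy : 2 ^+ i * a < y by rewrite ltNge; apply/negP => /imin; rewrite ltnn.
apply: (@le_trans _ _ (expR (s * (2 ^+ i.+1 * a)) * (2 ^+ i * a < y)%R%:R)%:E).
  by rewrite iy mulr1 lee_fin ler_expR ler_wpM2l.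
apply: (@le_trans _ _ (\sum_(j <oo) (expR (s * (2 ^+ j.+1 * a)) * (2 ^+ j * a < y)%R%:R)%:E)%E).
  apply: le_trans (nneseries_lim_ge i.+1 _) => //.
  by rewrite big_nat_recr//= leeDr// sume_ge0.
by rewrite leeDr// lee_fin expR_ge0.
Qed.

Definition mgf (s : R) : \bar R := (\int[P]_w (expR (s * Y w))%:E)%E.

Lemma measurable_mgf (s : R) : measurable_fun setT (fun w => (expR (s * Y w))%:E).
Proof.
apply/measurable_EFinP; apply: measurableT_comp => //.
by apply: measurable_funM => //; exact: measurable_cst.
Qed.

(** Here [a] is a truncation level. On the shell above 2^i a the growth of the exponential is at
    most W/4, where W = (2^i a)^d f(2^i a), while the tail contributes -W ln 2 <= -W/2. The
    remaining -W/4 is at most -f(1) (i+1)/4, a geometric series whose sum depends neither on [s] nor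
    on [a]. *)
Lemma mgf_bound : exists2 K0 : R, 0 <= K0 &
  forall s a : R, M0 < a -> 1 <= a -> 0 <= s -> s <= f a * a ^+ d' / 8 ->
    (mgf s <= (expR (s * a) + K0)%:E)%E.
Proof.
pose q := expR (- (f 1 / 4)).
have q0 : 0 < q by exact: expR_gt0.
have f1 : 0 < f 1 by exact: f_gt0.
have q1 : q < 1 by rewrite /q -[X in _ < X]expR0 ltr_expR; lra.
exists (1 / (1 - q)); first by rewrite divr_ge0// subr_ge0 ltW.
move=> s a Ma a1 s0 sa.
have a0 : 0 < a by lra.
have mS i : measurable [set w | 2 ^+ i * a < Y w].
  rewrite (_ : [set _ | _] = Y @^-1` `]2 ^+ i * a, +oo[%classic).
    by rewrite -[X in measurable X]setTI; exact: measurable_funP.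
  by apply/seteqP; split=> w /=; rewrite in_itv/= andbT.
have ind i w : (2 ^+ i * a < Y w)%R%:R = \1_[set w | 2 ^+ i * a < Y w] w :> R.
  rewrite indicE; case: (boolP (2 ^+ i * a < Y w)) => h.
    by rewrite mem_set.
  by rewrite memNset//=; exact/negP.
have term i : (\int[P]_w (expR (s * (2 ^+ i.+1 * a)) * (2 ^+ i * a < Y w)%R%:R)%:E
    <= (q ^+ i.+1)%:E)%E.
  under eq_integral do rewrite ind EFinM.
  rewrite ge0_integralZl//; last first.
    by apply/measurable_EFinP; exact: measurable_indic.
  rewrite integral_indic// setIT.
  have -> : (P : {measure set T -> \bar R}) [set w | 2 ^+ i * a < Y w] =
      (expR (- (ln 2 * ((2 ^+ i * a) ^+ d'.+1 * f (2 ^+ i * a)))))%:E.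
    apply: tail; apply: (lt_le_trans Ma).
    by apply: ler_peMl; [exact: ltW|rewrite exprn_ege1// ler1n].
  rewrite -EFinM lee_fin -expRD /q -expRM_natl ler_expR.
  have p1 : 1 <= 2 ^+ i :> R by rewrite exprn_ege1// ler1n.
  have pi : i.+1%:R <= 2 ^+ i :> R by rewrite -natrX ler_nat ltn_expl.
  have ff : f a <= f (2 ^+ i * a) by apply: f_incr => //; apply: ler_peMl => //; exact: ltW.
  have f1a : f 1 <= f a by exact: f_incr.
  have ad : 1 <= a ^+ d'.+1 by exact: exprn_ege1.
  have ad' : 0 <= a ^+ d' by rewrite exprn_ge0// ltW.
  have pd : 2 ^+ i <= (2 ^+ i) ^+ d'.+1 :> R by rewrite ler_eXnr.
  have fa0 : 0 < f a by exact: f_gt0.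
  set p := 2 ^+ i in p1 pi ff pd *.
  have e1 : s * (2 ^+ i.+1 * a) <= f a * a ^+ d'.+1 * p / 4.
    have -> : s * (2 ^+ i.+1 * a) = s * (2 * a * p) by rewrite exprS /p; ring.
    have -> : f a * a ^+ d'.+1 * p / 4 = (f a * a ^+ d' / 8) * (2 * a * p).
      by rewrite exprS; field.
    by apply: ler_wpM2r => //; rewrite !mulr_ge0//; lra.
  have e2 : f a * a ^+ d'.+1 * p <= (p * a) ^+ d'.+1 * f (p * a).
    rewrite exprMn [X in X <= _](_ : _ = p * a ^+ d'.+1 * f a); last by ring.
    apply: ler_pM => //; first by rewrite mulr_ge0//; lra.
      exact: ltW.
    by apply: ler_wpM2r => //; lra.
  have e3 : f 1 * i.+1%:R <= f a * a ^+ d'.+1 * p.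
    apply: ler_pM => //; first exact: ltW.
    by apply: (le_trans f1a); rewrite ler_peMr// ltW.
  have := @half_le_ln2 R.
  set W := (p * a) ^+ _ * _ in e2 *.
  have W0 : 0 <= W.
    by apply: le_trans e2; apply: le_trans e3; rewrite mulr_ge0// ltW.
  move=> /(ler_wpM2r W0) ln2W; lra.
apply: (@le_trans _ _ ((expR (s * a))%:E +
   \sum_(i <oo) \int[P]_w (expR (s * (2 ^+ i.+1 * a)) * (2 ^+ i * a < Y w)%R%:R)%:E)%E).
  have mt i : measurable_fun setT (fun w =>
      (expR (s * (2 ^+ i.+1 * a)) * (2 ^+ i * a < Y w)%R%:R)%:E).
    apply/measurable_EFinP; apply: measurable_funM => //.
    rewrite (_ : (fun w => _) = \1_[set w | 2 ^+ i * a < Y w]).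
      exact: measurable_indic.
    by apply/funext => w; rewrite ind.
  have t0 i w : (0 <= (expR (s * (2 ^+ i.+1 * a)) * (2 ^+ i * a < Y w)%R%:R)%:E)%E.
    by rewrite lee_fin mulr_ge0 ?expR_ge0.
  have mser : measurable_fun setT (fun w => \sum_(i <oo)
      (expR (s * (2 ^+ i.+1 * a)) * (2 ^+ i * a < Y w)%R%:R)%:E)%E.
    by apply: ge0_emeasurable_sum => //.
  rewrite -integral_nneseries//.
  have <- : (\int[P]_w (expR (s * a))%:E = (expR (s * a))%:E)%E.
    by rewrite integral_cst//= -[RHS]mule1; congr (_ * _)%E; exact: probability_setT.
  rewrite -ge0_integralD//; last by move=> w _; apply: nneseries_ge0.
  apply: ge0_le_integral => //.
  - exact: measurable_mgf.
  - exact: emeasurable_funD.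
  by move=> w _; apply: expR_dyadic_bound.
rewrite EFinD leeD2l//.
apply: (@le_trans _ _ (\sum_(i <oo) (q ^+ i.+1)%:E)%E).
  apply: lee_nneseries => i _; last exact: term.
  by move=> _; apply: integral_ge0 => w _; rewrite lee_fin mulr_ge0 ?expR_ge0.
apply: lime_le.
  by apply: is_cvg_nneseries => i _ _; rewrite lee_fin exprn_ge0// ltW.
apply: nearW => n; rewrite sumEFin lee_fin.
apply: le_trans (@geometric_le_lim R n 1 q _ _ _); rewrite ?ler01 ?gtr0_norm//.
rewrite /series /=; apply: ler_sum => i _; rewrite mul1r exprS ler_piMl ?exprn_ge0// ltW//.
Qed.

(** With truncation level a, the logarithmic moment is about s a <= 2^(k d') a, and [mgf_bound] asks
    for f(a) a^d' >= 8 s. Forcing a >= 2^(k/2) allows f(a) to be replaced by f(2^(k/2)), at the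
    price of an extra 2^(-k/2) in [h], which is summable. *)
Lemma mgf_summable : (0 < d')%N ->
  summable_tail (fun j => (f (2 ^+ j) `^ (d'%:R)^-1)^-1) ->
  exists h : nat -> R, [/\ forall k, 0 <= h k, summable_tail h &
    forall k s, 0 <= s -> s <= (2 ^+ k) ^+ d' ->
      (mgf s <= (expR ((2 ^+ k) ^+ d'.+1 * h k))%:E)%E].
Proof.
move=> d'0 hg; set g := fun j => _ in hg; have M0p : 0 < M0 by exact: M0_gt0.
have pow0 j : 0 < 2 ^+ j :> R by rewrite exprn_gt0.
have g0 j : 0 < g j by rewrite invr_gt0 powR_gt0// f_gt0.
have gE j : (g j ^+ d' * f (2 ^+ j) : R) = 1 :> R.
  have fj := f_gt0 (pow0 j).
  rewrite /g exprVn -(powR_mulrn d' (powR_ge0 _ _)) -powRrM mulVf ?pnatr_eq0 -?lt0n//.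
  by rewrite powRr1 ?mulVf ?gt_eqF// ltW.
have [K0 K00 hK0] := mgf_bound.
have [K1 K1E] : exists K1, K1 = ln (1 + K0) by exists (ln (1 + K0)).
have K10 : 0 <= K1 by rewrite K1E ln_ge0// lerDl.
have [M1 M1E] : exists M1, M1 = M0 + 1 by exists (M0 + 1).
(* The second term is z / 2^k. The first absorbs 2^j, M1 and K1, because 2^k 2^-j is at least 2^j,
   hence at least 1, for j the half of k. *)
exists (fun k => (1 + M1 + K1) * 2^-1 ^+ k./2 + 8 * g k./2).
have c0 : 0 <= 1 + M1 + K1 by move: M0_gt0 K10; rewrite M1E => ? ?; lra.
have half0 j : 0 <= 2^-1 ^+ j :> R by rewrite exprn_ge0.
split.
- by move=> k; rewrite addr_ge0// mulr_ge0// ltW.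
- apply: (@summable_tail_half _ (fun j => (1 + M1 + K1) * 2^-1 ^+ j + 8 * g j)).
    by move=> k; rewrite addr_ge0// mulr_ge0// ltW.
  apply: summable_tailD.
  + apply: summable_tailZ => //; apply: summable_tail_geometric; lra.
  + exact: summable_tailZ.
  + by move=> k; rewrite mulr_ge0.
  + by move=> k; rewrite mulr_ge0// ltW.
move=> k s s0 sk; set j := k./2.
(* a >= 2^(k/2) gives f a >= F := f (2^(k/2)), and a >= z makes F a^d' / 8 >= s. *)
pose z := 2 ^+ k * (8 * g j).
have z0 : 0 < z by rewrite !mulr_gt0.
pose a := 2 ^+ j + z + M1.
have j1 : 1 <= 2 ^+ j :> R by rewrite exprn_ege1// ler1n.
have Ma : M0 < a by rewrite /a; lra.
have a1 : 1 <= a by rewrite /a; lra.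
have jle : 2 ^+ j <= 2 ^+ k * 2^-1 ^+ j :> R.
  rewrite exprVn ler_pdivlMr// -exprD ler_weXn2l ?ler1n//.
  by rewrite addnn /j -[leqRHS]odd_double_half leq_addl.
have kle : 1 <= 2 ^+ k * 2^-1 ^+ j :> R by exact: le_trans jle.
have sa : s <= f a * a ^+ d' / 8.
  apply: (le_trans sk); rewrite ler_pdivlMr//.
  have fa : f (2 ^+ j) <= f a by apply: f_incr => //; rewrite /a; lra.
  have za : z ^+ d' <= a ^+ d'.
    by rewrite ler_pXn2r ?nnegrE ?(ltW z0)//; rewrite /a; lra.
  (* The factor 8 in [z] gives f(2^j) z^d' = 8^d' 2^(k d'), and 8^d' >= 8 because d' > 0; this pays
     for the division by 8 in [mgf_bound]. *)
  apply: (@le_trans _ _ (f (2 ^+ j) * z ^+ d')); last first.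
    by apply: ler_pM => //; [exact/ltW/f_gt0|rewrite exprn_ge0// ltW].
  have -> : f (2 ^+ j) * z ^+ d' = (2 ^+ k) ^+ d' * 8 ^+ d'.
    rewrite /z !exprMn; have gj := gE j.
    by transitivity ((2 ^+ k) ^+ d' * 8 ^+ d' * (g j ^+ d' * f (2 ^+ j))); [ring|rewrite gj; ring].
  rewrite ler_wpM2l ?exprn_ge0 ?(ltW (pow0 _))//.
  by apply: ler_eXnr => //; rewrite ler1n.
apply: (le_trans (hK0 s a Ma a1 s0 sa)); rewrite lee_fin.
apply: (@le_trans _ _ (expR (s * a) * (1 + K0))).
  rewrite [leRHS]mulrDr mulr1 lerD2l ler_peMl// -expR0 ler_expR mulr_ge0//; lra.
have -> : 1 + K0 = expR K1 by rewrite K1E lnK// posrE; lra.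
rewrite -expRD ler_expR exprSr.
set p := 2 ^+ k in sk jle kle sa *; set r := 2^-1 ^+ j in jle kle *.
have pd1 : 1 <= p ^+ d' by rewrite exprn_ege1// exprn_ege1// ler1n.
have h1 : s * a <= p ^+ d' * a by apply: ler_wpM2r => //; lra.
have h2 : a + K1 <= p * ((1 + M1 + K1) * r + 8 * g j).
  have -> : p * ((1 + M1 + K1) * r + 8 * g j) = p * r + M1 * (p * r) + K1 * (p * r) + z.
    by rewrite /z -/p; ring.
  have M10 : 0 <= M1 by lra.
  have := ler_peMr M10 kle; have := ler_peMr K10 kle.
  rewrite /a; lra.
rewrite -mulrA; apply: le_trans (ler_wpM2l _ h2); last lra.
have := ler_peMl K10 pd1; lra.
Qed.

End moment_generating.

(** * Paths and passage times *)

Section lattice_connections.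
Context (R : realType) (d : nat).
Implicit Types (x y z : 'rV[int]_d) (e : edge d) (u : edge d -> R).

Definition trav x (p : seq 'rV[int]_d) : set (edge d) :=
  [set e | has (fun v => joins e v.1 v.2) (zip (x :: p) p)].

Definition pcost u x p := \sum_(e \in trav x p) u e.

(** A certificate of an upper cost bound. Certificates compose additively, so routes are assembled
    without naming their paths. *)
Definition conn u x y (c : R) :=
  exists p, [/\ path (@adj d) x p, last x p = y & pcost u x p <= c].

Lemma trav_cons x y p : trav x (y :: p) = [set e | joins e x y] `|` trav y p.
Proof. by apply/seteqP; split=> e /=; [move=> /orP[]; [left|right]|move=> [|] h; apply/orP; [left|right]]. Qed.

Lemma trav_cat x p q : trav x (p ++ q) = trav x p `|` trav (last x p) q.
Proof.
elim: p x => [|y p IH] x /=.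
  by rewrite [trav x [::]](_ : _ = set0) ?set0U//; apply/seteqP; split.
by rewrite !trav_cons IH setUA.
Qed.

Lemma finite_trav x p : finite_set (trav x p).
Proof.
elim: p x => [|y p IH] x; first by apply: (@sub_finite_set _ _ set0).
rewrite trav_cons finite_setU; split => //.
have [[e0 h0]|hn] := pselect (exists e, joins e x y).
  apply: (@sub_finite_set _ _ [set e0]); last exact: finite_set1.
  by move=> e /= he; apply: joins_inj he h0.
by apply: (@sub_finite_set _ _ set0) => // e he; case: hn; exists e.
Qed.

Lemma ler_sum_uniq_sub (I : eqType) (l s : seq I) (F : I -> R) :
  (forall i, 0 <= F i) -> uniq l -> {subset l <= s} ->
  \sum_(i <- l) F i <= \sum_(i <- s) F i.
Proof.
move=> F0; elim: l s => [|i l IH] s /=; first by rewrite big_nil sumr_ge0.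
move=> /andP[il ul] ls; have si : i \in s by apply: ls; exact: mem_head.
rewrite big_cons [leRHS](big_rem i si)/=.
rewrite lerD2l; apply: IH => // j jl.
have ij : j != i by apply: contraNneq il => <-.
have js : j \in s by apply: ls; rewrite inE jl orbT.
by have := perm_mem (perm_to_rem si) j; rewrite js inE (negPf ij) /= => <-.
Qed.

Lemma fsum_le_sum u (A : set (edge d)) (s : seq (edge d)) :
  (forall e, 0 <= u e) -> finite_set A -> (forall e, A e -> e \in s) ->
  \sum_(e \in A) u e <= \sum_(e <- s) u e.
Proof.
move=> u0 fA As; rewrite fsbig_finite//; apply: ler_sum_uniq_sub => //.
by move=> e; rewrite in_fset_set// inE => /As.
Qed.

Lemma conn_le u x y c c' : c <= c' -> conn u x y c -> conn u x y c'.
Proof. by move=> cc' [p [? ? ?]]; exists p; split=> //; apply: le_trans cc'. Qed.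

Lemma conn_refl u x : conn u x x 0.
Proof.
exists [::]; split=> //; rewrite /pcost (_ : trav _ _ = set0) ?fsbig_set0//.
by apply/seteqP; split.
Qed.

(** An edge used by both pieces counts once on the left and twice on the right; nonnegativity gives
    the inequality. *)
Lemma conn_trans u x y z c c' : (forall e, 0 <= u e) ->
  conn u x y c -> conn u y z c' -> conn u x z (c + c').
Proof.
move=> u0 [p [pp lp cp]] [q [pq lq cq]]; exists (p ++ q); split.
- by rewrite cat_path pp lp.
- by rewrite last_cat lp.
apply: le_trans (lerD cp cq).
rewrite /pcost trav_cat lp.
rewrite [X in _ <= X + _]fsbig_finite; last exact: finite_trav.
rewrite [X in _ <= _ + X]fsbig_finite; last exact: finite_trav.
rewrite -big_cat/=; apply: fsum_le_sum => // [|e].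
  by rewrite finite_setU; split; exact: finite_trav.
rewrite mem_cat !in_fset_set; try exact: finite_trav.
by move=> [h|h]; apply/orP; [left|right]; exact: mem_set.
Qed.

Lemma conn_edge u x y e : joins e x y -> conn u x y (u e).
Proof.
move=> h; exists [:: y]; split=> //=; first by rewrite andbT; apply/adj_joinsP; exists e.
rewrite /pcost (_ : trav x [:: y] = [set e]) ?fsbig_set1//.
rewrite trav_cons (_ : trav y [::] = set0) ?setU0; last by apply/seteqP; split.
by apply/seteqP; split=> e' /=; [move=> h'; apply: joins_inj h' h|move=> ->].
Qed.

(** Edges of the image path lie in the image under [tau] of the traversed set. It serves for
    translations (blocks) and for the reflection (last leg). *)
Lemma conn_map u (rho : 'rV[int]_d -> 'rV[int]_d) (tau : edge d -> edge d) x y c :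
  (forall e, 0 <= u e) ->
  (forall e x y, joins e x y -> joins (tau e) (rho x) (rho y)) ->
  conn (u \o tau) x y c -> conn u (rho x) (rho y) c.
Proof.
move=> u0 hrho [p [pp lp cp]]; exists (map rho p); split.
- elim: p x pp {lp cp} => //= z p IH x /andP[xz pz]; rewrite IH// andbT.
  by have /adj_joinsP [e he] := xz; apply/adj_joinsP; exists (tau e); exact: hrho.
- by rewrite last_map lp.
apply: le_trans cp; rewrite /pcost [leRHS]fsbig_finite; last exact: finite_trav.
rewrite -(big_map tau xpredT u); apply: fsum_le_sum => //; first exact: finite_trav.
suff : trav (rho x) (map rho p) `<=` tau @` trav x p.
  move=> h e /h [e' he' <-]; apply: map_f; rewrite in_fset_set; last exact: finite_trav.
  exact: mem_set.
elim: p x pp {lp} => [x _ e|z p IH x /= /andP[xz pz] e] //.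
rewrite !trav_cons => -[/= he|/IH]; last first.
  by move=> /(_ pz) [e' he' <-]; exists e' => //; right.
have /adj_joinsP [e' he'] := xz; exists e'; first by left.
exact: joins_inj (hrho _ _ _ he') he.
Qed.

Lemma fpp_le (T : Type) (t : edge d -> T -> R) n w c :
  (forall e, 0 <= t e w) -> conn (t ^~ w) 0 (axis_point d n) c -> fpp t n w <= c.
Proof.
move=> t0 [p [pp lp cp]]; apply: le_trans cp; rewrite /fpp; apply: ge_inf.
  by exists 0 => _ [q _ <-]; exact: fsumr_ge0.
by exists p => //=; rewrite /fpp_path pp lp eqxx.
Qed.

Lemma fpp_ge (T : Type) (t : edge d -> T -> R) n w c :
  (exists p, @fpp_path d n p) ->
  (forall p, fpp_path n p -> c <= passage_time t p w) -> c <= fpp t n w.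
Proof.
move=> [p0 hp0] h; apply: lb_le_inf.
  by exists (passage_time t p0 w); exists p0.
by move=> _ [p hp <-]; exact: h.
Qed.

Lemma fpp_near (T : Type) (t : edge d -> T -> R) n w c :
  (exists p, @fpp_path d n p) -> (forall e, 0 <= t e w) ->
  fpp t n w < c -> exists2 p, fpp_path n p & passage_time t p w < c.
Proof.
move=> [p0 hp0] t0 hc.
have [||_ [p hp <-] hpc] := @inf_adherent R [set passage_time t p w | p in [set p | fpp_path n p]] (c - fpp t n w).
- by rewrite subr_gt0.
- split; first by exists (passage_time t p0 w); exists p0.
  by exists 0 => _ [q _ <-]; exact: fsumr_ge0.
by exists p => //; apply: lt_le_trans hpc _; rewrite addrC subrK.
Qed.

End lattice_connections.

(** * Coordinates along the axis, staircases, translations and reflection *)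

Section lattice_geometry.
Context (R : realType) (d' : nat).
Local Notation point := 'rV[int]_d'.+1.
Implicit Types (e : edge d'.+1) (u : edge d'.+1 -> R) (z : 'I_d' -> nat).

Definition pt (j : nat) z : point :=
  \row_i (if unlift ord0 i is Some l then (z l)%:Z else j%:Z).

Lemma pt_ord0 j z : pt j z ord0 ord0 = j.
Proof. by rewrite mxE unlift_none. Qed.

Lemma pt_lift j z l : pt j z ord0 (lift ord0 l) = z l.
Proof. by rewrite mxE liftK. Qed.

Lemma row_eqP (x y : point) : x ord0 ord0 = y ord0 ord0 ->
  (forall l, x ord0 (lift ord0 l) = y ord0 (lift ord0 l)) -> x = y.
Proof. by move=> h0 h; apply/rowP => i; case: (unliftP ord0 i) => [l ->|->]. Qed.

Lemma pt_axis n : pt n (fun=> 0%N) = axis_point d'.+1 n.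
Proof. by apply: row_eqP => [|l]; rewrite !mxE ?unlift_none ?liftK. Qed.

Lemma pt0 : pt 0 (fun=> 0%N) = 0.
Proof. by apply: row_eqP => [|l]; rewrite !mxE ?unlift_none ?liftK. Qed.

Lemma delta_ord0 (i : 'I_d'.+1) (k : 'I_d'.+1) :
  (delta_mx ord0 i : point) ord0 k = (k == i)%:R.
Proof. by rewrite mxE eqxx. Qed.

Lemma joins_pt0 j z : joins (pt j z, ord0) (pt j z) (pt j.+1 z).
Proof.
rewrite /joins /= eqxx /=; apply/orP; left; apply/eqP; apply: row_eqP => [|l].
  by rewrite [RHS]mxE delta_ord0 !pt_ord0 eqxx -addn1 PoszD.
by rewrite [RHS]mxE delta_ord0 !pt_lift addr0.
Qed.

Lemma joins_pt_lift j z z' l : z' l = (z l).+1 ->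
  (forall k, k != l -> z' k = z k) ->
  joins (pt j z, lift ord0 l) (pt j z) (pt j z').
Proof.
move=> zl zk; rewrite /joins /= eqxx /=; apply/orP; left; apply/eqP.
apply: row_eqP => [|k]; rewrite [RHS]mxE delta_ord0.
  by rewrite !pt_ord0 addr0.
rewrite !pt_lift (inj_eq (@lift_inj _ ord0)).
by have [->|kl] := eqVneq k l; rewrite ?zl ?zk// ?addr0// -addn1 PoszD.
Qed.

(** Both orientations are kept because the last leg of a route runs down a staircase that was built
    upwards. *)
Definition conn2 u x y c := conn u x y c /\ conn u y x c.

Lemma conn2_refl u x : conn2 u x x 0.
Proof. by split; exact: conn_refl. Qed.

Lemma conn2_trans u (x y x3 : point) (c c' : R) : (forall e, 0 <= u e) ->
  conn2 u x y c -> conn2 u y x3 c' -> conn2 u x x3 (c + c').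
Proof.
move=> u0 [h1 h2] [h3 h4]; split; first exact: conn_trans h1 h3.
by rewrite addrC; exact: conn_trans h4 h2.
Qed.

Lemma conn2_edge u x y e : joins e x y -> conn2 u x y (u e).
Proof. by move=> h; split; apply: conn_edge => //; rewrite joins_sym. Qed.

(* The transverse coordinates of a staircase are updated one at a time: m of them
   have already moved from level j to level j.+1. *)
Definition mix (q : nat -> 'I_d' -> nat) j (m : nat) (l : 'I_d') :=
  if (l < m)%N then q j.+1 l else q j l.

(** Each level takes one longitudinal step and then adjusts the transverse coordinates in order. The
    bound charges one edge for every coordinate, moved or not, so that its shape does not depend on
    the staircase. *)
Lemma staircase_conn u q K : (forall e, 0 <= u e) ->
  (forall j l, (q j l <= q j.+1 l <= (q j l).+1)%N) ->
  conn2 u (pt 0 (q 0%N)) (pt K (q K)) (\sum_(j < K) (u (pt j (q j), ord0) +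
     \sum_(l < d') u (pt j.+1 (mix q j l), lift ord0 l))).
Proof.
move=> u0 hq; elim: K => [|K IH]; first by rewrite big_ord0; exact: conn2_refl.
rewrite big_ord_recr /=; apply: (conn2_trans u0 IH).
apply: (conn2_trans u0 (conn2_edge _ (joins_pt0 _ _))).
have key m : (m <= d')%N -> conn2 u (pt K.+1 (q K)) (pt K.+1 (mix q K m))
    (\sum_(l < d' | (l < m)%N) u (pt K.+1 (mix q K l), lift ord0 l)).
  elim: m => [_|m IHm md].
    rewrite big_pred0 => [|l]; last by rewrite ltn0.
    rewrite (_ : mix q K 0 = q K); first exact: conn2_refl.
    by apply/funext => l; rewrite /mix ltn0.
  rewrite (bigD1 (Ordinal md)) //= addrC.
  rewrite (eq_bigl (fun l : 'I_d' => (l < m)%N)); last first.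
    move=> l; rewrite ltnS -val_eqE /= [RHS]ltn_neqAle andbC; done.
  apply: (conn2_trans u0 (IHm (ltnW md))).
  have mixne k : k != Ordinal md -> mix q K m.+1 k = mix q K m k.
    by rewrite -val_eqE /mix ltnS leq_eqVlt /= => /negPf ->.
  (* If the coordinate does not move, the trivial connection is used and the charged edge is pure
     surplus. *)
  have [e|ne] := eqVneq (q K.+1 (Ordinal md)) (q K (Ordinal md)).
    rewrite (_ : mix q K m.+1 = mix q K m).
      have [h1 h2] := conn2_refl u (pt K.+1 (mix q K m)).
      by split; apply: conn_le (u0 _) _.
    apply/funext => k; have [->|] := eqVneq k (Ordinal md); last exact: mixne.
    by rewrite /mix /= ltnn ltnS leqnn.
  apply: conn2_edge; apply: joins_pt_lift => //.
  rewrite /mix /= ltnn ltnS leqnn.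
  by have := hq K (Ordinal md); move: ne; lia.
have := key d' (leqnn _).
rewrite (_ : mix q K d' = q K.+1); last by apply/funext => l; rewrite /mix ltn_ord.
by rewrite [X in conn2 _ _ _ X -> _](eq_bigl xpredT)// => l; exact: ltn_ord.
Qed.

Lemma straight_conn u j n z : (forall e, 0 <= u e) ->
  conn u (pt j z) (pt (j + n) z) (\sum_(i < n) u (pt (j + i) z, ord0)).
Proof.
move=> u0; elim: n => [|n IH]; first by rewrite big_ord0 addn0; exact: conn_refl.
rewrite big_ord_recr /= addnS; apply: (conn_trans u0 IH); apply: conn_edge.
exact: joins_pt0.
Qed.

Lemma exists_fpp_path n : exists p, @fpp_path d'.+1 n p.
Proof.
have [|p [h1 h2 _]] := @straight_conn (fun=> 0) 0 n (fun=> 0%N); first by [].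
by exists p; rewrite /fpp_path -{1}pt0 h1 -pt0 h2 add0n pt_axis eqxx.
Qed.

Definition shift (v : point) e : edge d'.+1 := (e.1 + v, e.2).

Lemma shift_inj v : injective (shift v).
Proof. by move=> [x i] [y j] [/addIr -> ->]. Qed.

Lemma joins_shift v e x y : joins e x y -> joins (shift v e) (x + v) (y + v).
Proof.
by rewrite /joins /= addrAC !(inj_eq (addIr v)).
Qed.

Lemma ptD j z j' z' : pt j z + pt j' z' = pt (j + j') (fun l => z l + z' l)%N.
Proof.
by apply: row_eqP => [|l]; rewrite mxE ?pt_ord0 ?pt_lift PoszD.
Qed.

Definition refl (n : nat) (x : point) : point :=
  \row_i (if i == ord0 then n%:Z - x ord0 i else x ord0 i).

Lemma refl_ord0 n x : refl n x ord0 ord0 = n%:Z - x ord0 ord0.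
Proof. by rewrite mxE eqxx. Qed.

Lemma refl_lift n x l : refl n x ord0 (lift ord0 l) = x ord0 (lift ord0 l).
Proof. by rewrite mxE. Qed.

(** Reflection reverses longitudinal edges, so their representative base point is moved back by one
    unit. *)
Definition refl_edge (n : nat) e : edge d'.+1 :=
  (if e.2 == ord0 then refl n e.1 - delta_mx ord0 ord0 else refl n e.1, e.2).

Lemma refl_edgeK n : involutive (refl_edge n).
Proof.
move=> [x i]; rewrite /refl_edge /=; case: eqP => [->|_]; congr pair.
  apply: row_eqP => [|l]; rewrite !mxE !eqxx/=; lia.
by apply: row_eqP => [|l]; rewrite !mxE ?eqxx//=; lia.
Qed.

Lemma refl_delta0 n x :
  refl n (x + delta_mx ord0 ord0) = refl n x - delta_mx ord0 ord0.
Proof.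
apply: row_eqP => [|l].
  by rewrite refl_ord0 !mxE !eqxx/=; lia.
by rewrite refl_lift !mxE/=; lia.
Qed.

Lemma refl_delta n x i : i != ord0 ->
  refl n (x + delta_mx ord0 i) = refl n x + delta_mx ord0 i.
Proof.
move=> i0; apply: row_eqP => [|l]; last by rewrite refl_lift !mxE.
by rewrite refl_ord0 !mxE !eqxx/= eq_sym (negPf i0)/=; lia.
Qed.

Lemma refl_inj n : injective (refl n).
Proof.
move=> x y e; apply: row_eqP => [|l].
  by have := congr1 (fun v : point => v ord0 ord0) e; rewrite !refl_ord0; lia.
by have := congr1 (fun v : point => v ord0 (lift ord0 l)) e; rewrite !refl_lift.
Qed.

Lemma joins_refl n e x y : joins e x y -> joins (refl_edge n e) (refl n x) (refl n y).
Proof.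
case: e => a i; rewrite /joins /refl_edge /=; have [->|ne] := eqVneq i ord0.
  by rewrite subrK -refl_delta0 !(inj_eq (@refl_inj n)) orbC.
by rewrite -refl_delta// !(inj_eq (@refl_inj n)).
Qed.

Lemma refl_pt n j z : (j <= n)%N -> refl n (pt j z) = pt (n - j) z.
Proof.
move=> jn; apply: row_eqP => [|l]; rewrite ?refl_ord0 ?refl_lift ?pt_ord0 ?pt_lift//.
by rewrite subzn.
Qed.

End lattice_geometry.

(** * Staircase paths along rays *)

Section staircase_counting.
Context (d' : nat).

(* Level j of the discretised segment from the origin to (K, S m). *)
Definition ray (S K M : nat) (m : {ffun 'I_d' -> 'I_M}) (j : nat) (l : 'I_d') : nat :=
  ((j * (S * m l)) %/ K)%N.

(** For all x in one fibre, j S x lies in a window of length K. The fibre therefore has at most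
    (K-1)/(jS) + 1 elements, and multiplying by j <= K gives at most 2K. *)
Lemma fibre_bound (S K M j z : nat) : (0 < S)%N -> (0 < j)%N -> (j <= K)%N ->
  (#|[pred x : 'I_M | (j * (S * x)) %/ K == z]%N| * j <= 2 * K)%N.
Proof.
move=> S0 j0 jK.
set A := [pred x : 'I_M | _]; case: (pickP A) => [x0 x0A|A0]; last first.
  by rewrite eq_card0.
have K0 : (0 < K)%N by exact: leq_trans jK.
pose y := [arg min_(x < x0 | x \in A) (x : nat)].
have [yA ymin] : y \in A /\ forall x, x \in A -> (y <= x)%N.
  by rewrite /y; case: arg_minnP => // i iA imin; split.
pose w := ((K.-1) %/ (j * S)).+1.
have Aw : (#|A| <= w)%N.
  rewrite -[leqRHS]card_ord; pose f (x : 'I_M) : 'I_w := inord (x - y).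
  rewrite -(@card_in_imset _ _ f (mem A)); first exact: max_card.
  have lt x : x \in A -> (x - y < w)%N.
    move=> xA; rewrite /w ltnS leq_divRL ?muln_gt0 ?j0//.
    have := ymin x xA; move: xA yA; rewrite !inE => /eqP ex /eqP ey yx.
    have h1 := divn_eq (j * (S * x)) K; have h2 := divn_eq (j * (S * y)) K.
    have h3 := ltn_pmod (j * (S * x)) K0.
    have e : ((x - y) * (j * S) = j * (S * x) - j * (S * y))%N.
      by rewrite mulnBl; congr subn; ring.
    rewrite e; move: h1 h2; rewrite ex ey => h1 h2; lia.
  move=> x1 x2 A1 A2 /(congr1 val); rewrite /= !inordK ?lt// => e.
  apply: val_inj; rewrite /=.
  have := ymin _ A1; have := ymin _ A2; lia.
apply: (leq_trans (leq_mul Aw (leqnn j))).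
rewrite /w mulSn mul2n -addnn leq_add//.
apply: (@leq_trans (K.-1 %/ (j * S) * (j * S))).
  by rewrite leq_mul// leq_pmulr.
by apply: (leq_trans (leq_trunc_div _ _)); exact: leq_pred.
Qed.

(** For an unmoved coordinate at level j >= 1, j + 1 <= 2j turns 2K into 4K. At level 0 all rays
    share the origin, and M <= K bounds the fibre. *)
Lemma mix_fibre_bound (S K M j z : nat) (b : bool) : (0 < S)%N -> (j < K)%N ->
  (M <= K)%N ->
  (#|[pred x : 'I_M | (if b then (j.+1 * (S * x)) %/ K else (j * (S * x)) %/ K) == z]%N|
    * j.+1 <= 4 * K)%N.
Proof.
move=> S0 jK MK; case: b.
  have := @fibre_bound S K M j.+1 z S0 isT jK; lia.
case: j jK => [|j] jK.
  rewrite muln1; apply: (leq_trans (max_card _)); rewrite card_ord; lia.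
have := @fibre_bound S K M j.+1 z S0 isT (ltnW jK); lia.
Qed.

(** The transverse coordinates of the endpoint vary independently, so the fibre is a product of d'
    one-dimensional fibres. *)
Lemma ray_fibres (S K M j k : nat) (z : 'I_d' -> nat) : (0 < S)%N -> (j < K)%N ->
  (M <= K)%N ->
  (#|[pred m : {ffun 'I_d' -> 'I_M} | [forall l, mix (ray S K m) j k l == z l]]|
    * j.+1 ^ d' <= (4 * K) ^ d')%N.
Proof.
move=> S0 jK MK.
pose F (l : 'I_d') := [pred x : 'I_M | (if (l < k)%N then (j.+1 * (S * x)) %/ K
  else (j * (S * x)) %/ K) == z l]%N.
have -> : #|[pred m : {ffun 'I_d' -> 'I_M} | [forall l, mix (ray S K m) j k l == z l]]|
    = #|(family F : simpl_pred {ffun 'I_d' -> 'I_M})|.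
  apply: eq_card => m; rewrite !inE; apply: eq_forallb => l.
  by rewrite ?inE /= /mix /ray; case: ifP.
rewrite card_family foldrE big_map big_enum /=.
rewrite -[in X in (_ * X)%N](card_ord d') -[in leqRHS](card_ord d').
rewrite -!prod_nat_const -big_split /=.
by apply: leq_prod => l _; exact: mix_fibre_bound.
Qed.

Lemma ray0 S K M (m : {ffun 'I_d' -> 'I_M}) l : ray S K m 0 l = 0%N.
Proof. by rewrite /ray div0n. Qed.

Lemma rayK S K M (m : {ffun 'I_d' -> 'I_M}) l : (0 < K)%N -> ray S K m K l = (S * m l)%N.
Proof. by move=> K0; rewrite /ray mulKn. Qed.

(** The slope S m_l / K is at most 1, so the integer part rises by at most one per level. *)
Lemma ray_step S K M (m : {ffun 'I_d' -> 'I_M}) j l : (0 < K)%N -> (S * M <= K)%N ->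
  (ray S K m j l <= ray S K m j.+1 l <= (ray S K m j l).+1)%N.
Proof.
move=> K0 SMK; rewrite /ray mulSn.
have mK : (S * m l <= K)%N by apply: leq_trans SMK; rewrite leq_mul// ltnW.
rewrite leq_div2r ?leq_addl//=.
have -> : ((j * (S * m l)) %/ K).+1 = ((j * (S * m l) + K) %/ K)%N.
  by rewrite divnDr ?dvdnn// divnn K0 addn1.
by rewrite leq_div2r// addnC leq_add2l.
Qed.

Lemma mix_ray_lt S K M (m : {ffun 'I_d' -> 'I_M}) j k l : (0 < K)%N -> (S * M <= K)%N ->
  (mix (ray S K m) j k l < j.+2)%N.
Proof.
move=> K0 SMK.
have h i : (ray S K m i l <= i)%N.
  have mK : (S * m l <= K)%N by apply: leq_trans SMK; rewrite leq_mul// ltnW.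
  by rewrite /ray -[leqRHS](mulnK i K0) leq_div2r// leq_mul.
by rewrite /mix; case: ifP => _; rewrite ltnS ?h// leqW// h.
Qed.

End staircase_counting.

Lemma lee_prod_fin (R : realType) (K : Type) (r : seq K) (a : K -> \bar R) (b : K -> R) :
  (forall k, 0 <= a k)%E -> (forall k, (a k <= (b k)%:E)%E) ->
  (\prod_(k <- r) a k <= (\prod_(k <- r) b k)%:E)%E.
Proof.
move=> a0 ab; elim: r => [|k r IH]; first by rewrite !big_nil.
by rewrite !big_cons EFinM lee_pmul// prode_ge0.
Qed.

(** * Exponential moments of weighted sums of edge weights *)

Section exponential_moments.
Context (R : realType) (I : choiceType) (disp : measure_display)
  (T : measurableType disp) (P : probability T R) (X : I -> {RV P >-> R}).
Hypotheses (X_indep : mutually_independent X)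
  (X_ident : identically_distributed X).

Lemma field_integral (tau : I -> I) (phi : (I -> R) -> R) : injective tau ->
  measurable_fun [set: cfg R [set: I]] phi -> (forall u, 0 <= phi u) ->
  (\int[P]_w (phi (field X tau w))%:E = \int[P]_w (phi (field X id w))%:E)%E.
Proof.
move=> tau_inj mphi phi0.
have mf s := @measurable_field R I disp T P X setT s.
have mphiE : measurable_fun [set: cfg R [set: I]] (EFin \o phi) by apply/measurable_EFinP.
have pf s : (\int[P]_w (phi (field X s w))%:E =
    \int[pushforward P (field X s : T -> cfg R [set: I])]_u (EFin \o phi) u)%E.
  by rewrite (ge0_integral_pushforward (mf s))// => u _; rewrite lee_fin.
rewrite !pf.
pose m1 : {measure set (cfg R [set: I]) -> \bar R} :=
  measure_function_pushforward__canonical__measure_function_Measure P (mf tau).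
pose m2 : {measure set (cfg R [set: I]) -> \bar R} :=
  measure_function_pushforward__canonical__measure_function_Measure P (mf id).
change (\int[m1]_u (EFin \o phi) u = \int[m2]_u (EFin \o phi) u)%E.
by apply: eq_measure_integral => D mD _; exact: field_law.
Qed.

Lemma mgf_ident (i j : I) s : mgf (X i) s = mgf (X j) s.
Proof.
have m : measurable_fun [set: R] (fun x => (expR (s * x))%:E).
  apply/measurable_EFinP.
  apply: (@measurableT_comp _ _ _ R R R expR _ ( *%R s)); first exact: measurable_expR.
  exact: mulrl_measurable.
have e k : mgf (X k) s = (\int[distribution P (X k)]_x (expR (s * x))%:E)%E.
  by rewrite ge0_integral_distribution// => x; rewrite lee_fin expR_ge0.
rewrite !e; apply: eq_measure_integral => B mB _; exact: X_ident.
Qed.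

Lemma exp_linear_moment (i0 : I) (tau : I -> I) (K : eqType) (r : seq K) (E : K -> I)
    (c : K -> R) : injective tau -> uniq r -> injective E ->
  (\int[P]_w (expR (\sum_(k <- r) c k * field X tau w (E k)))%:E =
   \prod_(k <- r) mgf (X i0) (c k))%E.
Proof.
move=> tau_inj ur E_inj.
have mc k : measurable_fun [set: cfg R [set: I]] (fun u : cfg R [set: I] => expR (c k * u (E k))).
  apply: (@measurableT_comp _ _ _ _ _ _ expR _ (fun u : cfg R [set: I] => c k * u (E k))) => //.
  apply: (@measurable_funM _ (cfg R [set: I]) R setT (fun=> c k) (fun u => u (E k))).
    exact: measurable_cst.
  exact: measurable_coord.
under eq_integral do rewrite expR_sum.
rewrite (@field_integral tau (fun u => \prod_(k <- r) expR (c k * u (E k))))//; last 2 first.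
- by apply: measurable_prod => k _; exact: mc.
- by move=> u; apply: prodr_ge0 => k _; exact: expR_ge0.
rewrite (@expectation_prod _ _ _ _ _ _ X_indep X_ident K r (fun k => [set E k])
  (fun k u => expR (c k * u (E k))))//.
- by apply: eq_bigr => k _; rewrite -(mgf_ident (E k)).
- move=> k k' _ _ kk'; rewrite -subset0 => i [/= -> /E_inj kE].
  by rewrite kE eqxx in kk'.
- by move=> k u v uv; rewrite uv.
Qed.

End exponential_moments.

Section staircase_sums.
Context (R : realType) (d' : nat).
Local Notation edge := (edge d'.+1).

(* Direction 0 is the longitudinal step and starts at level j; the transverse steps
   follow at level j.+1, so that (j, i) determines the family of possible edges. *)
Definition stair_edge (j : nat) (i : 'I_d'.+1) (z : 'I_d' -> nat) : edge :=
  (pt (j + (0 < i))%N z, i).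

(** For the longitudinal step (i = 0) and the first transverse step (i = 1), [i.-1] is 0: no
    transverse coordinate has moved yet. *)
Definition stair_sum (S K M : nat) (u : edge -> R) : R :=
  \sum_(m : {ffun 'I_d' -> 'I_M}) \sum_(j < K) \sum_(i < d'.+1)
    u (stair_edge j i (mix (ray S K m) j i.-1)).

Lemma stair_edge_inj (K : nat) : injective (fun x : 'I_K * 'I_d'.+1 * {ffun 'I_d' -> 'I_K.+1} =>
  stair_edge x.1.1 x.1.2 (fun l => x.2 l)).
Proof.
move=> [[j i] z] [[j' i'] z'] [/= e ei].
subst i'; congr (_, _, _).
  have := congr1 (fun v : 'rV[int]_d'.+1 => v ord0 ord0) e; rewrite !pt_ord0 => -[].
  by move=> /addIn => ?; apply: val_inj.
apply/ffunP => l; have := congr1 (fun v : 'rV[int]_d'.+1 => v ord0 (lift ord0 l)) e.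
by rewrite !pt_lift => -[?]; apply: val_inj.
Qed.

Definition stair_mult (S K M : nat) (x : 'I_K * 'I_d'.+1 * {ffun 'I_d' -> 'I_K.+1}) : nat :=
  #|[pred m : {ffun 'I_d' -> 'I_M} |
     [forall l, mix (ray S K m) x.1.1 x.1.2.-1 l == x.2 l]]|.

(** Rays share edges, and only distinct edges carry independent weights, so the rays are grouped by
    the transverse position they occupy. Positions fit in ['I_K.+1] because slopes are at most 1. *)
Lemma stair_sumE S K M (u : edge -> R) : (0 < K)%N -> (S * M <= K)%N ->
  stair_sum S K M u = \sum_(x : 'I_K * 'I_d'.+1 * {ffun 'I_d' -> 'I_K.+1})
    (stair_mult S M x)%:R * u (stair_edge x.1.1 x.1.2 (fun l => x.2 l)).
Proof.
move=> K0 SMK; rewrite /stair_sum exchange_big /=.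
under eq_bigr do rewrite exchange_big /=.
rewrite pair_big /= -(pair_big xpredT xpredT (fun ji z => (stair_mult S M (ji, z))%:R *
  u (stair_edge ji.1 ji.2 (fun l => z l)))) /=.
apply: eq_bigr => -[j i] _ /=.
pose code (m : {ffun 'I_d' -> 'I_M}) : {ffun 'I_d' -> 'I_K.+1} :=
  [ffun l => inord (mix (ray S K m) j i.-1 l)].
have codeE m l : code m l = mix (ray S K m) j i.-1 l :> nat.
  rewrite ffunE inordK//; apply: leq_trans (mix_ray_lt _ _ _ _ K0 SMK) _.
  by rewrite ltnS.
rewrite (partition_big code xpredT)//=; apply: eq_bigr => z _.
rewrite (eq_bigr (fun=> u (stair_edge j i (fun l => z l)))); last first.
  by move=> m /eqP cm; congr (u (stair_edge _ _ _)); apply/funext => l; rewrite -cm codeE.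
rewrite sumr_const mulr_natl; congr (_ *+ _); apply: eq_card => m.
rewrite !inE; apply/idP/forallP => [h l|h].
  by have cz : code m = z by [exact/eqP]; rewrite -cz codeE.
change (is_true (code m == z)).
apply/eqP/ffunP => l; apply: val_inj; rewrite /= codeE; exact/eqP/h.
Qed.

Lemma stair_mult_bound S K M x : (0 < S)%N -> (M <= K)%N ->
  (@stair_mult S K M x * x.1.1.+1 ^ d' <= (4 * K) ^ d')%N.
Proof. by move=> S0 MK; exact: ray_fibres. Qed.

(** At level j the rays occupy only transverse coordinates below j + 2, by [mix_ray_lt]. *)
Lemma stair_support S K M (j : 'I_K) (i : 'I_d'.+1) : (0 < K)%N -> (S * M <= K)%N ->
  (#|[pred z : {ffun 'I_d' -> 'I_K.+1} | (0 < stair_mult S M (j, i, z))%N]| <= j.+2 ^ d')%N.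
Proof.
move=> K0 SMK.
have sub : (#|[pred z : {ffun 'I_d' -> 'I_K.+1} | (0 < stair_mult S M (j, i, z))%N]|
    <= #|@ffun_on 'I_d' [pred y : 'I_K.+1 | (y < j.+2)%N]|)%N.
  apply: subset_leq_card; apply/fintype.subsetP => z; rewrite !inE /stair_mult.
  move=> /card_gt0P [m /forallP /= hm]; apply/ffun_onP => l; rewrite inE.
  by rewrite -(eqP (hm l)); exact: mix_ray_lt.
apply: (leq_trans sub); rewrite card_ffun_on card_ord; have [->//|d0] := posnP d'.
rewrite leq_exp2r// -[leqRHS]card_ord.
pose f (y : 'I_K.+1) : 'I_j.+2 := inord y.
rewrite -(@card_in_imset _ _ f [pred y : 'I_K.+1 | (y < j.+2)%N]); first exact: max_card.
by move=> y y' yj y'j /(congr1 val); rewrite /= !inordK// => /val_inj.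
Qed.

End staircase_sums.

(** * Deviations along the rays *)

Lemma exp_markov (R : realType) (disp : measure_display) (T : measurableType disp)
    (P : probability T R) (Z : T -> R) (s a : R) : 0 < s -> measurable_fun setT Z ->
  (P [set w | (a <= Z w)%R] <= \int[P]_w (expR (s * Z w))%:E * (expR (- (s * a)))%:E)%E.
Proof.
move=> s0 mZ; pose X : {RV P >-> R} := mfun_Sub (mem_set mZ).
have := chernoff X a s0; rewrite /mmt_gen_fun unlock /=.
set LHS := (P _ <= _)%E => h.
suff -> : (\int[P]_w (expR (s * Z w))%:E = \int[P]_x (expR (Z x * s))%:E)%E by [].
by apply: eq_integral => w _; rewrite mulrC.
Qed.

(** This k is the scale at which an edge of level j is seen: Chernoff will give it an inverse
    temperature of at most (n/(j+1))^d' <= 2^(k d'). *)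
Lemma dyadic_scale (n j : nat) : (j < n)%N ->
  let k := (trunc_log 2 (n %/ j.+1)).+1 in
  (n < 2 ^ k * j.+1)%N /\ (2 ^ k * j.+1 <= 2 * n)%N.
Proof.
move=> jn k.
have q0 : (0 < n %/ j.+1)%N by rewrite divn_gt0.
have /andP[h1 h2] := @trunc_log_bounds 2 (n %/ j.+1) isT q0.
split; first by rewrite -ltn_divLR.
rewrite /k expnS -mulnA leq_mul2l /=.
by apply: leq_trans (leq_trunc_div n j.+1); rewrite leq_mul.
Qed.

(** A scale k is shared by at most 2n/2^k levels j, each with 1/(j+1) <= 2^k/n, so its total weight
    is at most 2. Since 2^k0 K <= n, scales below k0 do not occur. *)
Lemma dyadic_sum (R : realType) (h : nat -> R) (n K k0 : nat) :
  (forall k, 0 <= h k) -> (K <= n)%N -> (2 ^ k0 * K <= n)%N ->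
  \sum_(j < K) h (trunc_log 2 (n %/ j.+1)).+1 / j.+1%:R <=
  2 * \sum_(k0 <= k < n.+2) h k.
Proof.
move=> h0 Kn kn; pose kap j := (trunc_log 2 (n %/ j.+1)).+1.
have scale (j : 'I_K) := dyadic_scale (leq_trans (ltn_ord j) Kn).
have kapb (j : 'I_K) : (k0 <= kap j < n.+2)%N.
  have jn := leq_trans (ltn_ord j) Kn.
  apply/andP; split.
    have [h1 _] := scale j.
    rewrite -ltnS -(@ltn_exp2l 2)//.
    have : (2 ^ k0 * j.+1 < 2 ^ (kap j) * j.+1)%N.
      apply: leq_ltn_trans h1; apply: leq_trans kn.
      by rewrite leq_mul2l (ltn_ord j) orbT.
    rewrite ltn_mul2r /= => /leq_trans; apply.
    by rewrite leq_exp2l.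
  rewrite /kap !ltnS; have [_ h2] := scale j.
  have q0 : (0 < n %/ j.+1)%N by rewrite divn_gt0.
  have /andP[h3 _] := @trunc_log_bounds 2 (n %/ j.+1) isT q0.
  apply: ltnW; apply: (@leq_trans (2 ^ trunc_log 2 (n %/ j.+1))); first exact: ltn_expl.
  by apply: leq_trans h3 _; exact: leq_div.
have -> : \sum_(j < K) h (kap j) / j.+1%:R =
   \sum_(k0 <= k < n.+2) \sum_(j < K) (kap j == k)%:R * (h k / j.+1%:R).
  rewrite exchange_big /=; apply: eq_bigr => j _.
  rewrite (bigD1_seq (kap j)) ?iota_uniq//= ?eqxx ?mul1r; last first.
    by rewrite mem_index_iota kapb.
  rewrite [X in _ = _ + X]big1 ?addr0// => k kj.
  by rewrite eq_sym (negPf kj) mul0r.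
rewrite mulr_sumr; apply: ler_sum => k _.
apply: (@le_trans _ _ (\sum_(j < K) (h k * ((kap j == k)%:R / j.+1%:R)))).
  by apply: ler_sum => j _; rewrite mulrCA.
rewrite -mulr_sumr mulrC ler_wpM2r//.
have [n0|n0] := posnP n.
  rewrite big1 ?ler0n// => j _; have := leq_trans (ltn_ord j) Kn.
  by rewrite n0.
pose A := [pred j : 'I_K | kap j == k].
have cA : (#|A| * 2 ^ k <= 2 * n)%N.
  rewrite -leq_divRL ?expn_gt0//.
  have [A0|/card_gt0P [j0 j0A]] := posnP #|A|; first by rewrite A0.
  have lt j : j \in A -> (j < (2 * n) %/ 2 ^ k)%N.
    rewrite inE => /eqP <-; rewrite leq_divRL ?expn_gt0// mulnC.
    by have [_] := scale j.
  have := lt j0 j0A; case: (_ %/ _)%N lt => // q lt _.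
  rewrite -[leqRHS](card_ord q.+1).
  rewrite -(@card_in_imset _ _ (fun j : 'I_K => inord j : 'I_q.+1) A); first exact: max_card.
  move=> j j' jA j'A /(congr1 val); rewrite /= !inordK ?lt// => ?.
  exact: val_inj.
apply: (@le_trans _ _ (\sum_(j < K | j \in A) (2 ^ k)%:R / n%:R)).
  rewrite [leRHS]big_mkcond /=; apply: ler_sum => j _; rewrite inE.
  case: eqP => [kj|_]; last by rewrite mul0r.
  rewrite mul1r ler_pdivlMr ?ltr0n// mulrC ler_pdivrMr ?ltr0n// -natrM ler_nat.
  by have [h1 _] := scale j; rewrite -kj ltnW.
by rewrite sumr_const -mulrnAl -mulrnA ler_pdivrMr ?ltr0n// -natrM ler_nat mulnC.
Qed.

Section staircase_deviation.
Context (R : realType) (d' : nat) (disp : measure_display)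
  (T : measurableType disp) (P : probability T R)
  (t : edge d'.+1 -> {RV P >-> R}).
Hypotheses (t_indep : mutually_independent t)
  (t_ident : identically_distributed t).
Variables (e0 : edge d'.+1) (h : nat -> R).
Hypotheses (h_ge0 : forall k, 0 <= h k)
  (h_mgf : forall (k : nat) (s : R), 0 <= s -> s <= (2 ^+ k) ^+ d' ->
    (mgf (t e0) s <= (expR ((2 ^+ k) ^+ d'.+1 * h k))%:E)%E).

Lemma mgf0 e : mgf (t e) 0 = 1%E.
Proof.
rewrite /mgf; under eq_integral do rewrite mul0r expR0.
by rewrite integral_cst//= mul1e; exact: probability_setT.
Qed.

Lemma mgf_ge0 e s : (0 <= mgf (t e) s)%E.
Proof. by apply: integral_ge0 => w _; rewrite lee_fin expR_ge0. Qed.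

(** The moment factors over distinct edges. Hypothesis [hs] and the multiplicity bound put the
    inverse temperature of an edge of level j within the range allowed at scale [kap j];
    [stair_support] counts the edges involved. *)
Lemma stair_moment (tau : edge d'.+1 -> edge d'.+1) (S K M : nat) (kap : nat -> nat)
    (s : R) : injective tau -> (0 < S)%N -> (0 < K)%N -> (S * M <= K)%N -> 0 <= s ->
  (forall j, (j < K)%N -> s * ((4 * K) ^ d')%:R <= ((2 ^ kap j * j.+1) ^ d')%:R) ->
  (\int[P]_w (expR (s * stair_sum S K M (field t tau w)))%:E <=
   (expR (\sum_(j < K) (d'.+1 * j.+2 ^ d')%:R * ((2 ^+ kap j) ^+ d'.+1 * h (kap j))))%:E)%E.
Proof.
move=> tau_inj S0 K0 SMK s0 hs.
have MK : (M <= K)%N by apply: leq_trans SMK; rewrite leq_pmull.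
pose E (x : 'I_K * 'I_d'.+1 * {ffun 'I_d' -> 'I_K.+1}) : edge d'.+1 :=
  stair_edge x.1.1 x.1.2 (fun l => x.2 l).
pose c (x : 'I_K * 'I_d'.+1 * {ffun 'I_d' -> 'I_K.+1}) : R := s * (stair_mult S M x)%:R.
have -> : (\int[P]_w (expR (s * stair_sum S K M (field t tau w)))%:E =
    \int[P]_w (expR (\sum_(x : 'I_K * 'I_d'.+1 * {ffun 'I_d' -> 'I_K.+1}) c x * field t tau w (E x)))%:E)%E.
  apply: eq_integral => w _; rewrite stair_sumE// mulr_sumr.
  by congr (expR _)%:E; apply: eq_bigr => x _; rewrite mulrA.
rewrite (@exp_linear_moment R _ _ _ P t t_indep t_ident e0 tau _ _ E c)//; last 2 first.
- exact: index_enum_uniq.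
- exact: stair_edge_inj.
pose H (j : nat) := (2 ^+ kap j) ^+ d'.+1 * h (kap j).
have H0 j : 0 <= H j by rewrite mulr_ge0// !exprn_ge0.
(* The 0-1 factor keeps only edges met by some ray: the others have coefficient 0 and moment exactly
   1. Otherwise every position in the box would be charged. *)
apply: (@le_trans _ _ (\prod_(x : 'I_K * 'I_d'.+1 * {ffun 'I_d' -> 'I_K.+1})
    expR ((0 < stair_mult S M x)%N%:R * H x.1.1))%:E).
  apply: lee_prod_fin => x; first exact: mgf_ge0.
  rewrite /c; case: posnP => [->|m0]; first by rewrite mulr0 mgf0 mul0r expR0.
  rewrite mul1r; apply: h_mgf; first by rewrite mulr_ge0.
  have j0 : 0 < (x.1.1.+1 ^ d')%:R :> R by rewrite ltr0n expn_gt0.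
  rewrite -(ler_pM2r j0).
  apply: (@le_trans _ _ (s * ((4 * K) ^ d')%:R)).
    by rewrite -mulrA -natrM ler_wpM2l// ler_nat; exact: stair_mult_bound.
  apply: le_trans (hs _ (ltn_ord x.1.1)) _.
  by rewrite expnMn natrM !natrX lexx.
rewrite lee_fin -expR_sum ler_expR.
rewrite -(pair_big xpredT xpredT (fun (ji : 'I_K * 'I_d'.+1) (z : {ffun 'I_d' -> 'I_K.+1}) =>
  (0 < stair_mult S M (ji, z))%N%:R * H ji.1)) /=.
rewrite -(pair_big xpredT xpredT (fun (j : 'I_K) (i : 'I_d'.+1) =>
  \sum_(z : {ffun 'I_d' -> 'I_K.+1}) (0 < stair_mult S M (j, i, z))%N%:R * H j)) /=.
apply: ler_sum => j _; rewrite -/(H j) natrM -mulrA.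
apply: (@le_trans _ _ (\sum_(i < d'.+1) (j.+2 ^ d')%:R * H j)); last first.
  by rewrite sumr_const card_ord [leRHS]mulr_natl.
apply: ler_sum => i _; rewrite -mulr_suml ler_wpM2r//.
rewrite -natr_sum ler_nat; apply: leq_trans (stair_support j i K0 SMK).
rewrite -sum1_card [leqRHS]big_mkcond /=; apply: leq_sum => z _.
by rewrite inE /=; case: ifP.
Qed.

Lemma measurable_stair_sum (tau : edge d'.+1 -> edge d'.+1) (S K M : nat) :
  measurable_fun setT (fun w => stair_sum S K M (field t tau w)).
Proof.
by do 3 (apply: measurable_sum => ?); exact: measurable_funP.
Qed.

(** Chernoff: the logarithmic moment costs a constant times n^d eta, while the threshold gains s
    M^d' eps n, which is at least n^d eps/(8S)^d' because K <= 2 S M. *)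
Lemma stair_deviation (tau : edge d'.+1 -> edge d'.+1) (S K M n k0 : nat) (eps eta : R) :
  injective tau -> (0 < S)%N -> (0 < M)%N -> (S * M <= K)%N -> (K <= 2 * (S * M))%N ->
  (2 ^ k0 * K <= n)%N -> 0 < eps ->
  (forall J, \sum_(k0 <= k < J) h k <= eta) ->
  (P [set w | (M ^ d')%:R * (eps * n%:R) <= stair_sum S K M (field t tau w)]%R <=
   (expR (n%:R ^+ d'.+1 * ((d'.+1 * 2 ^ d' * 2 ^ d'.+1 * 2)%:R * eta -
       eps / (8 * S%:R) ^+ d')))%:E)%E.
Proof.
move=> tau_inj S0 M0 SMK KSM kn eps0 hJ.
have K0 : (0 < K)%N by apply: leq_trans SMK; rewrite muln_gt0 S0.
have Kn : (K <= n)%N by apply: leq_trans kn; rewrite leq_pmull// expn_gt0.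
have n0 : (0 < n)%N by exact: leq_trans Kn.
pose kap j := (trunc_log 2 (n %/ j.+1)).+1.
have scale (j : nat) : (j < K)%N -> _ := fun jK => dyadic_scale (leq_trans jK Kn).
have K4 : 0 < (4 * K)%:R :> R by rewrite ltr0n muln_gt0.
(* An edge of level j meets at most (4K/(j+1))^d' rays, so this choice gives it inverse temperature
   at most (n/(j+1))^d'. *)
pose s : R := (n%:R / (4 * K)%:R) ^+ d'.
have s0 : 0 < s by rewrite exprn_gt0// divr_gt0// ltr0n.
have hs j : (j < K)%N -> s * ((4 * K) ^ d')%:R <= ((2 ^ kap j * j.+1) ^ d')%:R.
  move=> jK; rewrite natrX -exprMn divfK ?gt_eqF// -natrX ler_nat.
  have [->|d0] := posnP d'; first by rewrite !expn0.
  by rewrite leq_exp2r// ltnW//; have [] := scale j jK.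
apply: (le_trans (exp_markov _ _ s0 (measurable_stair_sum tau S K M))).
apply: (le_trans (lee_wpmul2r _ (stair_moment tau_inj S0 K0 SMK (ltW s0) hs))).
  by rewrite lee_fin expR_ge0.
rewrite -EFinM lee_fin -expRD ler_expR mulrBr; apply: lerD.
  (* The factors are d' + 1 for the directions, 2^d' from j + 2 <= 2(j+1), and 2^(d'+1) from 2^(kap
     j) (j+1) <= 2n. A last factor 2 will come from [dyadic_sum]. *)
  apply: (@le_trans _ _ (\sum_(j < K) (d'.+1 * 2 ^ d' * 2 ^ d'.+1)%:R * n%:R ^+ d'.+1 *
      (h (kap j) / j.+1%:R))).
    apply: ler_sum => j _; rewrite [leLHS]mulrA [h _ / _]mulrC [leRHS]mulrA ler_wpM2r//.
    rewrite ler_pdivlMr ?ltr0n// -!natrX -!natrM ler_nat.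
    have [_ h2] := scale j (ltn_ord j).
    rewrite -!mulnA leq_mul2l /=.
    apply: (@leq_trans ((2 * j.+1) ^ d' * ((2 ^ kap j) ^ d'.+1 * j.+1))%N).
      rewrite leq_mul2r; apply/orP; right.
      by have [->|d0] := posnP d'; rewrite ?expn0// leq_exp2r//; lia.
    rewrite expnMn -!mulnA leq_mul2l; apply/orP; right.
    have -> : (j.+1 ^ d' * ((2 ^ kap j) ^ d'.+1 * j.+1) = (2 ^ kap j * j.+1) ^ d'.+1)%N.
      by rewrite expnMn [(j.+1 ^ d'.+1)%N]expnSr; ring.
    by rewrite -expnMn leq_exp2r.
  rewrite -mulr_sumr [_ * n%:R ^+ _]mulrC -mulrA ler_wpM2l ?exprn_ge0//.
  rewrite [X in _ <= X * _]natrM -mulrA ler_wpM2l//.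
  apply: (le_trans (@dyadic_sum R h n K k0 h_ge0 Kn kn)).
  by rewrite ler_wpM2l.
rewrite lerN2.
have S8 : 0 < 8 * S%:R :> R by rewrite mulr_gt0// ltr0n.
have MK4 : (8 * S%:R)^-1 <= M%:R / (4 * K)%:R :> R.
  rewrite ler_pdivlMr// mulrC ler_pdivrMr// -!natrM ler_nat.
  by rewrite [leqRHS]mulnC -mulnA -[8%N]/(4 * 2)%N -mulnA leq_mul2l /=; lia.
have -> : s * ((M ^ d')%:R * (eps * n%:R)) =
    n%:R ^+ d'.+1 * eps * (M%:R / (4 * K)%:R) ^+ d'.
  rewrite /s natrX !exprMn exprS; ring.
rewrite mulrA -exprVn ler_wpM2l ?mulr_ge0 ?exprn_ge0 ?(ltW eps0)//.
have [->|d0] := posnP d'; first by rewrite !expr0.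
by rewrite ler_pXn2r ?nnegrE ?invr_ge0 ?divr_ge0// ltW.
Qed.

End staircase_deviation.

(** * Blocks and tubes *)

Section blocks.
Context (R : realType) (d' : nat).
Local Notation edge := (edge d'.+1).
Implicit Types (u : edge -> R).

Definition box (L : nat) : set edge :=
  [set e : edge | forall i : 'I_d'.+1, (absz (e.1 ord0 i) <= L)%N].

Definition good_paths (N L : nat) : set (seq 'rV[int]_d'.+1) :=
  [set p | fpp_path N p /\ trav 0 p `<=` box L].

Definition good (N L : nat) (c : R) : set (edge -> R) :=
  \bigcup_(p in good_paths N L) [set u | pcost u 0 p <= c].

Definition line (N : nat) u : R := \sum_(i < N) u (pt i (fun=> 0%N), ord0).

(** An upper bound for the block's passage time that depends only on edges of a finite box (when N
    <= L). Being constant on the good event, it needs a moment estimate only for the straight line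
    on the bad event. *)
Definition block (N L : nat) (c : R) u : R :=
  if u \in good N L c then c else line N u.

Lemma measurable_pcost x p :
  measurable_fun [set: cfg R [set: edge]] (fun u : cfg R [set: edge] => pcost u x p).
Proof.
rewrite (_ : (fun u => _) = fun u => \sum_(e <- fset_set (trav x p)) u e).
  by apply: measurable_sum => e; exact: measurable_coord.
by apply/funext => u; rewrite /pcost fsbig_finite//; exact: finite_trav.
Qed.

Lemma pcost_depends x p : depends_on (trav x p) (fun u => pcost u x p).
Proof. by move=> u v uv; apply: eq_fsbigr => e /set_mem; exact: uv. Qed.

Lemma measurable_good N L c : measurable (good N L c : set (cfg R [set: edge])).
Proof.
rewrite /good bigcup_mkcond; apply: countable_bigcupT_measurable.
  exact: countableP.
move=> p; case: ifP => // _.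
rewrite (_ : [set _ | _] = (fun u : cfg R [set: edge] => pcost u 0 p) @^-1` `]-oo, c]%classic).
  by rewrite -[X in measurable X]setTI; exact: measurable_pcost.
by apply/seteqP; split => u /=; rewrite in_itv.
Qed.

Lemma good_depends N L c : depends_on (box L) (fun u => u \in good N L c).
Proof.
suff h u v : (forall e, box L e -> u e = v e) -> u \in good N L c -> v \in good N L c.
  move=> u v uv; apply/idP/idP; apply: h => // e Le; exact/esym/uv.
move=> uv; rewrite !inE => -[p [pp pL] /= up]; exists p => //=.
rewrite -(@pcost_depends 0 p u v)// => e pe; exact/uv/pL.
Qed.

Lemma line_depends N L : (N <= L)%N -> depends_on (box L) (line N).
Proof.
move=> NL u v uv; apply: eq_bigr => i _; apply: uv => k /=.
rewrite mxE; case: unlift => [l|]//=.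
by apply: leq_trans NL; exact: ltnW.
Qed.

Lemma block_depends N L c : (N <= L)%N -> depends_on (box L) (block N L c).
Proof.
move=> NL u v uv; rewrite /block (good_depends N c uv).
by case: ifP => // _; exact: line_depends uv.
Qed.

Lemma measurable_line N : measurable_fun [set: cfg R [set: edge]] (line N).
Proof. by apply: measurable_sum => i; exact: measurable_coord. Qed.

Lemma measurable_block N L c : measurable_fun [set: cfg R [set: edge]] (block N L c).
Proof.
rewrite (_ : block N L c = (fun u => \1_(good N L c) u * c + \1_(~` good N L c) u * line N u)).
  apply: measurable_funD; apply: measurable_funM.
  - apply: measurable_indic; exact: measurable_good.
  - exact: measurable_cst.
  - apply: measurable_indic; apply: measurableC; exact: measurable_good.
  - exact: measurable_line.
apply/funext => u; rewrite /block !indicE in_setC; case: ifP => _ /=.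
  by rewrite mul1r mul0r addr0.
by rewrite mul0r add0r mul1r.
Qed.

Lemma block_conn N L c u : (forall e, 0 <= u e) ->
  conn u 0 (axis_point d'.+1 N) (block N L c u).
Proof.
move=> u0; rewrite /block; case: ifPn => [|_].
  by rewrite inE => -[p [/andP[pp /eqP lp] _] up]; exists p; split.
by have := straight_conn 0 N (fun=> 0%N) u0; rewrite pt0 add0n pt_axis.
Qed.

Lemma finite_in_box (A : set edge) : finite_set A -> exists L, A `<=` box L.
Proof.
move=> fA; exists (\max_(e <- fset_set A) \max_(i < d'.+1) absz (e.1 ord0 i))%N.
move=> e Ae i; have eA : e \in fset_set A by rewrite in_fset_set// mem_set.
apply: (@leq_trans (\max_(i < d'.+1) absz (e.1 ord0 i))%N).
  exact: (@leq_bigmax _ (fun i => absz (e.1 ord0 i))).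
by rewrite (big_rem e)//= leq_maxl.
Qed.

Lemma box_mono L L' : (L <= L')%N -> box L `<=` box L'.
Proof. by move=> LL' e h i; exact: leq_trans (h i) _. Qed.

Lemma good_mono N L L' c : (L <= L')%N -> good N L c `<=` good N L' c.
Proof.
move=> LL' u [p [pp pL] up]; exists p => //; split => //.
by apply: subset_trans pL _; exact: box_mono.
Qed.

Lemma good_cover N c u : (forall e, 0 <= u e) ->
  fpp (fun e (v : edge -> R) => v e) N u < c -> exists L, good N L c u.
Proof.
move=> u0 /(fpp_near (exists_fpp_path R d' N) u0) [p pp pc].
have [L hL] := finite_in_box (finite_trav 0 p).
by exists L; exists p => //=; exact: ltW.
Qed.

End blocks.

Lemma expR_mean_le (R : realType) (N : nat) (x : nat -> R) : (0 < N)%N ->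
  expR ((\sum_(i < N) x i) / N%:R) <= (\sum_(i < N) expR (x i)) / N%:R.
Proof.
move=> N0; have N0' : 0 < N%:R :> R by rewrite ltr0n.
set m := _ / N%:R; rewrite ler_pdivlMr//.
(* tangent line of expR at the mean *)
apply: (@le_trans _ _ (\sum_(i < N) expR m * (1 + (x i - m)))).
  rewrite -mulr_sumr big_split /= sumr_const card_ord sumrB sumr_const card_ord.
  rewrite ler_wpM2l ?expR_ge0// /m -[_ / _ *+ N]mulr_natr divfK ?gt_eqF//.
  by rewrite subrr addr0.
apply: ler_sum => i _; rewrite -ler_pdivlMl ?expR_gt0//.
by rewrite mulrC -expRB; exact: expR_ge1Dx.
Qed.

Section block_law.
Context (R : realType) (d' : nat) (disp : measure_display)
  (T : measurableType disp) (P : probability T R)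
  (t : edge d'.+1 -> {RV P >-> R}).
Hypotheses (t_indep : mutually_independent t)
  (t_ident : identically_distributed t)
  (t_ge0 : forall e w, 0 <= t e w).

Lemma measurable_passage p :
  measurable_fun setT (fun w => passage_time (fun e => t e : T -> R) p w).
Proof.
apply: (@measurableT_comp _ _ _ _ (cfg R [set: edge d'.+1]) R (fun u => pcost u 0 p) _
  (field t id)); [exact: measurable_pcost|exact: measurable_field].
Qed.

Lemma fpp_geE n c : [set w | c <= fpp (fun e => t e : T -> R) n w] =
  \bigcap_(p in [set p | @fpp_path d'.+1 n p])
    [set w | c <= passage_time (fun e => t e : T -> R) p w].
Proof.
apply/seteqP; split=> w /=.
  move=> cw p pp; apply: (le_trans cw); rewrite /fpp; apply: ge_inf; last by exists p.
  by exists 0 => _ [q _ <-]; apply: fsumr_ge0 => e _; exact: t_ge0.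
by move=> h; apply: fpp_ge => [|p pp]; [exact: (exists_fpp_path R)|exact: h].
Qed.

Lemma measurable_fpp_ge n c :
  measurable [set w | c <= fpp (fun e => t e : T -> R) n w].
Proof.
rewrite fpp_geE -[X in measurable X]setCK setC_bigcap; apply: measurableC.
rewrite bigcup_mkcond; apply: countable_bigcupT_measurable; first exact: countableP.
move=> p; case: ifP => // _; apply: measurableC.
rewrite (_ : [set _ | _] = (fun w => passage_time (fun e => t e : T -> R) p w) @^-1` `[c, +oo[%classic).
  by rewrite -[X in measurable X]setTI; exact: measurable_passage.
by apply/seteqP; split => w /=; rewrite in_itv /= andbT.
Qed.

Variables (nu : R).
Hypothesis nu_lim : {ae P, forall w : T,
     fpp (fun e => t e : T -> R) n w / n%:R @[n --> \oo] --> nu}.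

(** Almost sure convergence makes the event of infinitely many exceedances null; continuity from
    above then gives a small probability at one N. *)
Lemma fpp_ge_prob_small (eps eta : R) : 0 < eps -> 0 < eta ->
  exists2 N, (0 < N)%N &
  (P [set w | ((nu + eps) * N%:R <= fpp (fun e => t e : T -> R) N w)%R] <= eta%:E)%E.
Proof.
move=> eps0 eta0.
(* The shift to [n.+1] guarantees N > 0 and permits division by the length. *)
pose A n := [set w | (nu + eps) * n.+1%:R <= fpp (fun e => t e : T -> R) n.+1 w].
pose D n := \bigcup_(m in [set m | (n <= m)%N]) A m.
have mA n : measurable (A n) by exact: measurable_fpp_ge.
have mD n : measurable (D n) by apply: bigcup_measurable.
have mDD : measurable (\bigcap_n D n) by apply: bigcapT_measurable.
have Dn : {homo D : n m / (n <= m)%N >-> (m <= n)%O}.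
  move=> n m nm; apply/subsetPset => w [k /= mk Ak]; exists k => //=.
  exact: leq_trans mk.
have PD : P (\bigcap_n D n) = 0%E.
  apply/negligibleP => //; have [N [mN PN hN]] := nu_lim.
  exists N; split => // w hw; apply: hN => /= hlim.
  move/cvgrPdist_lt : hlim => /(_ _ eps0) [m _ hm].
  have [k /= mk Ak] := hw m I.
  have := hm k.+1 (leqW mk); rewrite distrC => /(le_lt_trans (ler_norm _)).
  by rewrite ltrBlDr addrC ltr_pdivrMr ?ltr0n// ltNge Ak.
have Dfin : (P (D 0%N) < +oo)%E by rewrite (le_lt_trans (probability_le1 _ (mD 0%N)))// ltry.
have : P (D n) @[n --> \oo] --> 0%E.
  by rewrite -PD; exact: (nonincreasing_cvg_mu Dfin mD mDD Dn).
move=> /fine_cvgP[_ /cvgrPdist_lt /(_ _ eta0)] [N _ hN].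
exists N.+1 => //.
have := hN N (leqnn N); rewrite /= sub0r normrN => hlt.
apply: (@le_trans _ _ (P (D N))).
  by apply: le_measure; rewrite ?inE//; [exact: mA|move=> w hw; exists N => //=].
rewrite -(fineK (fin_num_measure P _ (mD N))) lee_fin.
by apply: ltW; apply: le_lt_trans hlt; exact: ler_norm.
Qed.

(** A path of cost below c is finite, so it fits in some box. The bad events thus decrease, as L
    grows, to a subset of the event c <= [fpp]. *)
Lemma good_prob (N : nat) (c eta : R) : 0 < eta ->
  (P [set w | (c <= fpp (fun e => t e : T -> R) N w)%R] <= eta%:E)%E ->
  exists2 L, (N <= L)%N & (P (field t id @^-1` (~` good N L c)) <= (2 * eta)%:E)%E.
Proof.
move=> eta0 hP.
have mf := @measurable_field R _ _ T P t setT id.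
pose B L := field t id @^-1` (~` good N L c).
have mB L : measurable (B L).
  rewrite -[X in measurable X]setTI; apply: mf => //.
  by apply: measurableC; exact: measurable_good.
have mBB : measurable (\bigcap_L B L) by apply: bigcapT_measurable.
have Bn : {homo B : n m / (n <= m)%N >-> (m <= n)%O}.
  move=> n m nm; apply/subsetPset => w /= hw; apply: contra_not hw.
  exact: good_mono.
have Bfin : (P (B 0%N) < +oo)%E by rewrite (le_lt_trans (probability_le1 _ (mB 0%N)))// ltry.
have PBB : (P (\bigcap_L B L) <= eta%:E)%E.
  apply: le_trans hP; apply: le_measure; rewrite ?inE//; first exact: measurable_fpp_ge.
  move=> w hw /=; rewrite leNgt; apply/negP => hlt.
  have [L hL] := @good_cover R d' N c (field t id w) (t_ge0 ^~ w) hlt.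
  exact: (hw L I).
have : P (B n) @[n --> \oo] --> (fine (P (\bigcap_L B L)))%:E.
  rewrite fineK ?fin_num_measure//.
  exact: (nonincreasing_cvg_mu Bfin mB mBB Bn).
move=> /fine_cvgP[_ /cvgrPdist_lt /(_ _ eta0)] [L _ hL].
exists (maxn N L); first exact: leq_maxl.
have := hL (maxn N L) (leq_maxr _ _); rewrite /= -/(B _) => hlt.
rewrite -/(B _) -(fineK (fin_num_measure P _ (mB _))) lee_fin.
move: PBB; rewrite -(fineK (fin_num_measure P _ mBB)) lee_fin => PBB.
move/ltW/ler_normlP : hlt => [h1 h2]; lra.
Qed.

(** On the bad event the exponential is truncated at B, which costs B times the bad probability. The
    excess is controlled by the moment at 2; convexity bounds it by an average over the N edges of
    the line, so that G does not grow with N. *)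
Lemma block_moment (N L : nat) (c B eta G : R) (e0 : edge d'.+1) :
  (0 < N)%N -> 0 < B -> (N <= L)%N ->
  (mgf (t e0) 2 <= G%:E)%E ->
  (P (field t id @^-1` (~` good N L c)) <= eta%:E)%E ->
  (\int[P]_w (expR (block N L c (field t id w) / N%:R))%:E <=
    (expR (c / N%:R) + B * eta + G / B)%:E)%E.
Proof.
move=> N0 B0 NL hG hbad.
have N0' : 0 < N%:R :> R by rewrite ltr0n.
set bad := field t id @^-1` (~` good N L c) in hbad *.
have mbad : measurable bad.
  rewrite -[X in measurable X]setTI; apply: (@measurable_field R _ _ T P t setT id) => //.
  by apply: measurableC; exact: measurable_good.
pose g i w := expR (2 * t (pt i (fun=> 0%N), ord0) w).
have mg i : measurable_fun setT (g i).
  by apply/measurable_EFinP; exact: measurable_mgf.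
have m1 : measurable_fun setT (fun w => (B * \1_bad w)%:E).
  apply/measurable_EFinP; apply: measurable_funM; first exact: measurable_cst.
  exact: measurable_indic.
have m2 i : measurable_fun setT (fun w => ((B * N%:R)^-1 * g i w)%:E).
  by apply/measurable_EFinP; apply: measurable_funM => //; exact: measurable_cst.
have m3 : measurable_fun setT (fun w => (\sum_(i < N) (B * N%:R)^-1 * g i w)%:E).
  apply/measurable_EFinP; apply: measurable_sum => i; exact/measurable_EFinP/m2.
have BN0 : 0 <= (B * N%:R)^-1 by rewrite invr_ge0 mulr_ge0// ltW.
have g2 i w : 0 <= (B * N%:R)^-1 * g i w by rewrite mulr_ge0 ?expR_ge0.
apply: (@le_trans _ _ (\int[P]_w ((expR (c / N%:R))%:E + (B * \1_bad w)%:E +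
    (\sum_(i < N) (B * N%:R)^-1 * g i w)%:E))%E).
  apply: ge0_le_integral => //.
  - apply/measurable_EFinP; apply: measurableT_comp => //; apply: measurable_funM => //.
    apply: (@measurableT_comp _ _ _ _ (cfg R [set: edge d'.+1]) R (block N L c) _
      (field t id)); [exact: measurable_block|exact: measurable_field].
  - by apply: emeasurable_funD => //; exact: emeasurable_funD.
  move=> w _; rewrite -!EFinD lee_fin /block indicE.
  have S0 : 0 <= \sum_(i < N) (B * N%:R)^-1 * g i w.
    by apply: sumr_ge0 => i _; rewrite mulr_ge0 ?expR_ge0// invr_ge0 mulr_ge0// ltW.
  case: ifPn => [gd|bd].
    by rewrite -addrA lerDl addr_ge0// mulr_ge0// ltW.
  have -> : (w \in bad) = true.
    by rewrite mem_set//= => gd; move: bd; rewrite mem_set.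
  rewrite mulr1 -mulr_sumr; rewrite -mulr_sumr in S0; set v := line _ _ / _.
  have hv : expR (2 * v) <= (\sum_(i < N) g i w) / N%:R.
    have := expR_mean_le (fun i => 2 * t (pt i (fun=> 0%N), ord0) w) N0.
    by rewrite -mulr_sumr -mulrA.
  have e0' : 0 < expR (c / N%:R) by exact: expR_gt0.
  (* e^v <= B + e^(2v) / B *)
  have [vB|Bv] := leP (expR v) B; first lra.
  suff : expR v <= (B * N%:R)^-1 * \sum_(i < N) g i w by lra.
  rewrite invfM -mulrA [N%:R^-1 * _]mulrC ler_pdivlMl//.
  apply: le_trans hv; rewrite mulr_natl mulr2n expRD ler_wpM2r ?expR_ge0//.
  exact: ltW.
have i0 w : 0 <= B * \1_bad w by rewrite mulr_ge0// ltW.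
rewrite ge0_integralD//; [|by move=> w _; rewrite -EFinD lee_fin addr_ge0 ?expR_ge0
  |exact: emeasurable_funD|by move=> w _; rewrite lee_fin sumr_ge0].
rewrite EFinD; apply: leeD.
  rewrite ge0_integralD//; last by move=> w _; rewrite lee_fin.
  rewrite EFinD; apply: leeD.
    rewrite integral_cst//=.
    by have -> : (P : {measure set T -> \bar R}) setT = 1%E; [exact: probability_setT|rewrite mule1].
  under eq_integral do rewrite EFinM.
  rewrite ge0_integralZl//; last 2 first.
  - by apply/measurable_EFinP; exact: measurable_indic.
  - by rewrite lee_fin ltW.
  rewrite integral_indic// setIT EFinM.
  by rewrite lee_wpmul2l// lee_fin ltW.
under eq_integral do rewrite -sumEFin.
rewrite ge0_integral_sum//; last by move=> i w _; rewrite lee_fin.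
apply: (@le_trans _ _ (\sum_(i < N) ((B * N%:R)^-1 * G)%:E)%E).
  apply: lee_sum => i _; under eq_integral do rewrite EFinM.
  rewrite ge0_integralZl//; last 2 first.
  - by apply/measurable_EFinP; exact: mg.
  - by move=> w _; rewrite lee_fin expR_ge0.
  rewrite EFinM lee_wpmul2l//; apply: le_trans hG.
  by rewrite -(mgf_ident t_ident (pt i (fun=> 0%N), ord0)).
rewrite sumEFin lee_fin sumr_const card_ord [leLHS](_ : _ = G / B)//.
by rewrite -[LHS]mulr_natl; field; rewrite !gt_eqF.
Qed.

Lemma block_exists (eps G : R) (e0 : edge d'.+1) : 0 < eps -> (mgf (t e0) 2 <= G%:E)%E ->
  exists N L : nat, [/\ (0 < N)%N, (N <= L)%N &
    (\int[P]_w (expR (block N L ((nu + eps) * N%:R) (field t id w) / N%:R))%:E <=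
     (expR (nu + 2 * eps))%:E)%E].
Proof.
move=> eps0 hG.
have G0 : 0 <= G.
  by rewrite -lee_fin; apply: le_trans hG; apply: integral_ge0 => w _; rewrite lee_fin expR_ge0.
pose Delta := expR (nu + 2 * eps) - expR (nu + eps).
have D0 : 0 < Delta by rewrite subr_gt0 ltr_expR; lra.
(* B is chosen to make G/B at most Delta/2, and [eta] so that B (2 eta) = Delta/2. Both are fixed
   before N, as G does not involve N. *)
pose B := 2 * (G + 1) / Delta.
have B0 : 0 < B by rewrite divr_gt0//; lra.
pose eta := Delta / (4 * B).
have eta0 : 0 < eta by rewrite divr_gt0//; lra.
have [N N0 hN] := fpp_ge_prob_small eps0 eta0.
have [L NL hL] := good_prob eta0 hN.
exists N, L; split => //.
apply: (le_trans (block_moment N0 B0 NL hG hL)).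
rewrite lee_fin mulfK ?gt_eqF ?ltr0n//.
have -> : B * (2 * eta) = Delta / 2 by rewrite /eta; field; rewrite gt_eqF.
have -> : G / B = G * Delta / (2 * (G + 1)) by rewrite /B invf_div mulrA.
suff : G * Delta / (2 * (G + 1)) <= Delta / 2 by rewrite /Delta; lra.
rewrite ler_pdivrMr; last lra.
nra.
Qed.

End block_law.

(** * Independent translates of one block *)

Section tubes.
Context (R : realType) (d' : nat) (disp : measure_display)
  (T : measurableType disp) (P : probability T R)
  (t : edge d'.+1 -> {RV P >-> R}).
Hypotheses (t_indep : mutually_independent t)
  (t_ident : identically_distributed t).
Variables (N L S : nat) (c : R).
Hypotheses (N_gt0 : (0 < N)%N) (NL : (N <= L)%N) (LS : (2 * L < S)%N).

Definition site (o a M : nat) (m : {ffun 'I_d' -> 'I_M}) : 'rV[int]_d'.+1 :=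
  pt (o + S * a) (fun l => (S * m l)%N).

Lemma multiple_close (x y : nat) (a b : int) :
  (absz a <= L)%N -> (absz b <= L)%N -> a + (S * x)%N%:Z = b + (S * y)%N%:Z -> x = y.
Proof.
move=> aL bL e; apply/eqP; rewrite eqn_leq; apply/andP; split; rewrite leqNgt; apply/negP => lt.
  have : (S * y.+1 <= S * x)%N by rewrite leq_mul.
  rewrite mulnS; lia.
have : (S * x.+1 <= S * y)%N by rewrite leq_mul.
rewrite mulnS; lia.
Qed.

(** The sites are spaced by S > 2L, more than the width of a box in each coordinate. *)
Lemma shift_box_disjoint (o A M : nat) (k k' : 'I_A * {ffun 'I_d' -> 'I_M}) : k != k' ->
  [set shift (site o k.1 k.2) e | e in box L] `&`
  [set shift (site o k'.1 k'.2) e | e in box L] = set0.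
Proof.
move=> kk'; rewrite -subset0 => _ [[[x i] /= xL <-] [[x' i'] /= x'L [e _]]].
have ei j : x ord0 j + site o k.1 k.2 ord0 j = x' ord0 j + site o k'.1 k'.2 ord0 j.
  by have := congr1 (fun v : 'rV[int]_d'.+1 => v ord0 j) e; rewrite !mxE => ->.
move/eqP : kk'; apply; case: k k' e ei => a m [a' m'] /= e ei; congr pair.
  apply: val_inj; apply: (multiple_close (xL ord0) (x'L ord0)).
  by have := ei ord0; rewrite !pt_ord0 !PoszD addrCA [RHS]addrCA => /addrI.
apply/ffunP => l; apply: val_inj.
apply: (multiple_close (xL (lift ord0 l)) (x'L (lift ord0 l))).
by have := ei (lift ord0 l); rewrite !pt_lift.
Qed.

Definition block_at (v : 'rV[int]_d'.+1) (u : edge d'.+1 -> R) : R :=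
  block N L c (u \o shift v).

Lemma measurable_block_at v : measurable_fun [set: cfg R [set: edge d'.+1]] (block_at v).
Proof.
apply: (@measurableT_comp _ _ _ _ (cfg R [set: edge d'.+1]) R (block N L c) _
   (fun u : cfg R [set: edge d'.+1] => u \o shift v)); first exact: measurable_block.
by apply: measurable_into_cfg => e _; exact: measurable_coord.
Qed.

Lemma block_at_depends v : depends_on [set shift v e | e in box L] (block_at v).
Proof.
move=> u u' uu'; apply: (block_depends c NL) => e Le /=; apply: uu'.
by exists e.
Qed.

(** Chernoff at inverse temperature 1 for A M^d' independent blocks of one residue class;
    translation invariance gives each of them the moment bound [hX]. *)
Lemma class_deviation (o A M : nat) (a b : R) :
  (\int[P]_w (expR (block N L c (field t id w) / N%:R))%:E <= (expR a)%:E)%E ->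
  (P [set w | (b * (A * M ^ d')%:R <=
      \sum_(k : 'I_A * {ffun 'I_d' -> 'I_M}) block_at (site o k.1 k.2) (field t id w) / N%:R)%R] <=
   (expR ((a - b) * (A * M ^ d')%:R))%:E)%E.
Proof.
move=> hX.
pose phi (k : 'I_A * {ffun 'I_d' -> 'I_M}) (u : edge d'.+1 -> R) :=
  expR (block_at (site o k.1 k.2) u / N%:R).
have mphi k : measurable_fun [set: cfg R [set: edge d'.+1]] (phi k).
  apply: (@measurableT_comp _ _ _ (cfg R [set: edge d'.+1]) R R expR setT (fun u => block_at (site o k.1 k.2) u / N%:R)) => //.
  apply: measurable_funM; [exact: measurable_block_at|exact: measurable_cst].
have mZ : measurable_fun setT (fun w => \sum_(k : 'I_A * {ffun 'I_d' -> 'I_M})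
    block_at (site o k.1 k.2) (field t id w) / N%:R).
  apply: measurable_sum => k; apply: measurable_funM => //.
  apply: (@measurableT_comp _ _ _ _ (cfg R [set: edge d'.+1]) R (block_at (site o k.1 k.2)) _
    (field t id)); [exact: measurable_block_at|exact: measurable_field].
apply: (le_trans (exp_markov _ _ ltr01 mZ)).
rewrite mul1r [X in (X * _)%E](_ : _ = \int[P]_w (\prod_k phi k (field t id w))%:E)%E; last first.
  by apply: eq_integral => w _; rewrite mul1r expR_sum.
rewrite (@expectation_prod _ _ _ _ _ t t_indep t_ident _ _
  (fun k : 'I_A * {ffun 'I_d' -> 'I_M} => [set shift (site o k.1 k.2) e | e in box L]) phi)//; last 4 first.
- exact: index_enum_uniq.
- by move=> k k' _ _; exact: shift_box_disjoint.
- by move=> k u u' uu'; rewrite /phi (block_at_depends uu').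
- by move=> k u; exact: expR_ge0.
have card_idx : #|{: 'I_A * {ffun 'I_d' -> 'I_M}}| = (A * M ^ d')%N.
  by rewrite card_prod card_ord card_ffun !card_ord.
apply: (@le_trans _ _ ((\prod_(k : 'I_A * {ffun 'I_d' -> 'I_M}) expR a)%:E *
    (expR (- (b * (A * M ^ d')%:R)))%:E)%E).
  apply: lee_wpmul2r; first by rewrite lee_fin expR_ge0.
  apply: lee_prod_fin => k; first by apply: integral_ge0 => w _; rewrite lee_fin expR_ge0.
  apply: le_trans hX.
  have := @field_integral R _ _ T P t t_indep t_ident (shift (site o k.1 k.2))
    (fun u => expR (block N L c u / N%:R)) (@shift_inj _ _).
  move=> <-; [exact: lexx| |by move=> u; exact: expR_ge0].
  apply: (@measurableT_comp _ _ _ (cfg R [set: edge d'.+1]) R R expR setT (fun u => block N L c u / N%:R)) => //.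
  apply: measurable_funM; [exact: measurable_block|exact: measurable_cst].
rewrite prodr_const card_idx -expRM_natl -EFinM lee_fin -expRD ler_expR.
by rewrite le_eqVlt; apply/orP; left; apply/eqP; ring.
Qed.

End tubes.

(** * Assembling ray, tube and reflected ray into a route *)

Section route.
Context (R : realType) (d' : nat).
Local Notation edge := (edge d'.+1).
Implicit Types (u : edge -> R).

Lemma stair_conn (S K M : nat) (m : {ffun 'I_d' -> 'I_M}) u : (forall e, 0 <= u e) ->
  (0 < K)%N -> (S * M <= K)%N ->
  conn2 u 0 (pt K (fun l => (S * m l)%N)) (\sum_(j < K) \sum_(i < d'.+1)
    u (stair_edge j i (mix (ray S K m) j i.-1))).
Proof.
move=> u0 K0 SMK.
have := @staircase_conn R d' u (ray S K m) K u0 (fun j l => ray_step m j l K0 SMK).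
rewrite (_ : ray S K m 0 = fun=> 0%N); last by apply/funext => l; exact: ray0.
rewrite (_ : ray S K m K = fun l => (S * m l)%N); last by apply/funext => l; exact: rayK.
rewrite pt0 (eq_bigr (fun j : 'I_K => \sum_(i < d'.+1)
    u (stair_edge j i (mix (ray S K m) j i.-1))))// => j _.
rewrite big_ord_recl /=; congr (u (_, _) + _); first by rewrite addn0.
by apply: eq_bigr => l _; rewrite /stair_edge /= addn1.
Qed.

Lemma block_at_conn (N L : nat) (c : R) (z : 'I_d' -> nat) (j : nat) u : (forall e, 0 <= u e) ->
  conn u (pt j z) (pt (j + N) z) (block_at N L c (pt j z) u).
Proof.
move=> u0; have := @block_conn R d' N L c (u \o shift (pt j z)) (fun e => u0 _).
move=> /(@conn_map R _ u (fun x => x + pt j z) (shift (pt j z)) _ _ _ u0).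
rewrite add0r -pt_axis ptD addnC; apply.
by move=> e x y; exact: joins_shift.
Qed.

Lemma row_conn (N L h o : nat) (c : R) (z : 'I_d' -> nat) u : (forall e, 0 <= u e) ->
  conn u (pt o z) (pt (o + N * h) z) (\sum_(b < h) block_at N L c (pt (o + N * b) z) u).
Proof.
move=> u0; elim: h => [|h IH]; first by rewrite big_ord0 muln0 addn0; exact: conn_refl.
rewrite big_ord_recr /=; apply: (conn_trans u0 IH).
have := block_at_conn N L c z (o + N * h) u0.
by rewrite mulnS [(N + _)%N]addnC !addnA.
Qed.

Lemma tube_conn (N L h A o : nat) (c : R) (z : 'I_d' -> nat) u : (forall e, 0 <= u e) ->
  conn u (pt o z) (pt (o + N * h * A) z)
    (\sum_(a < A) \sum_(b < h) block_at N L c (pt (o + N * b + N * h * a) z) u).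
Proof.
move=> u0; elim: A => [|A IH]; first by rewrite big_ord0 muln0 addn0; exact: conn_refl.
rewrite big_ord_recr /=; apply: (conn_trans u0 IH).
have := row_conn N L h (o + N * h * A) c z u0.
rewrite mulnS [(N * h + _)%N]addnC addnA.
by under [X in _ -> conn _ _ _ X]eq_bigr do rewrite addnAC.
Qed.

(** Each endpoint m gives one route from 0 to the axis point, and all M^d' bounds are added. The
    last leg is a staircase in the reflected environment, mapped back and run in reverse; its length
    K2 is free in order to absorb the remainder of n. *)
Lemma route_bound (N L h A M K2 n : nat) (c : R) u : (forall e, 0 <= u e) ->
  (0 < M)%N -> (0 < N * h)%N -> (N * h * M <= K2)%N ->
  n = (N * h * M + N * h * A + K2)%N ->
  (M ^ d')%:R * fpp (fun e (v : edge -> R) => v e) n u <=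
  stair_sum (N * h) (N * h * M) M u +
  (\sum_(b < h) \sum_(k : 'I_A * {ffun 'I_d' -> 'I_M})
    block_at N L c (site (N * h) (N * h * M + N * b) k.1 k.2) u) +
  stair_sum (N * h) K2 M (u \o refl_edge n).
Proof.
move=> u0 M0 S0 SK2 nE; set S := (N * h)%N in S0 SK2 nE *.
have K10 : (0 < S * M)%N by rewrite muln_gt0 S0.
have K20 : (0 < K2)%N by exact: leq_trans SK2.
have tubeE : \sum_(b < h) \sum_(k : 'I_A * {ffun 'I_d' -> 'I_M})
    block_at N L c (site S (S * M + N * b) k.1 k.2) u =
  \sum_(m : {ffun 'I_d' -> 'I_M}) \sum_(a < A) \sum_(b < h)
    block_at N L c (site S (S * M + N * b) a m) u.
  rewrite exchange_big /= -(pair_big xpredT xpredT (fun (a : 'I_A) (m : {ffun 'I_d' -> 'I_M}) =>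
    \sum_(b < h) block_at N L c (site S (S * M + N * b) a m) u)) /=.
  by rewrite exchange_big.
rewrite tubeE /stair_sum -!big_split /=.
have -> : (M ^ d')%:R * fpp (fun e (v : edge -> R) => v e) n u =
    \sum_(m : {ffun 'I_d' -> 'I_M}) fpp (fun e (v : edge -> R) => v e) n u.
  by rewrite sumr_const card_ffun !card_ord mulr_natl.
apply: ler_sum => m _; apply: fpp_le => //.
have [c1 _] := stair_conn m u0 K10 (leqnn _).
have c2 := tube_conn N L h A (S * M) c (fun l => (S * m l)%N) u0.
have [_ c3] := @stair_conn S K2 M m (u \o refl_edge n) (fun e => u0 _) K20 SK2.
apply: (conn_trans u0); first exact: (conn_trans u0 c1 c2).
have := @conn_map R _ u (refl n) (refl_edge n) _ _ _ u0 (fun e x y => @joins_refl d' n e x y) c3.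
rewrite refl_pt; last by rewrite nE leq_addl.
by rewrite -pt0 refl_pt// subn0 pt_axis nE addnK.
Qed.

End route.

(** * Exponential upper bound *)

(** Take n = S n' + r, M = n'/Q rounded down and A = n' - 2M. Large Q keeps the rays short compared
    with n, while n <= 4QSM keeps the number of tubes of order n^d'. *)
Lemma split_length (S Q n : nat) : (0 < S)%N -> (4 <= Q)%N -> (S * Q <= n)%N ->
  exists M A r, [/\ (0 < M)%N, (M <= A)%N, (r < S)%N,
    n = (S * M + S * A + (S * M + r))%N & (Q * (S * M) <= n /\ n <= 4 * Q * S * M)%N].
Proof.
move=> S0 Q4 nSQ; have Q0 : (0 < Q)%N by exact: leq_trans Q4.
have rS : (n %% S < S)%N by rewrite ltn_pmod.
have nE := divn_eq n S.
have n'Q : (Q <= n %/ S)%N by rewrite leq_divRL// mulnC.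
move: (n %/ S)%N (n %% S)%N nE n'Q rS => n' r nE n'Q rS.
have M0 : (0 < n' %/ Q)%N by rewrite divn_gt0.
have MQ : (n' %/ Q * Q <= n')%N by exact: leq_trunc_div.
have MQ2 : (n' < (n' %/ Q).+1 * Q)%N by rewrite -ltn_divLR.
move: (n' %/ Q)%N M0 MQ MQ2 => M M0 MQ MQ2.
have M4 : (4 * M <= n')%N by apply: leq_trans MQ; rewrite mulnC leq_mul2l Q4 orbT.
have h1 : (n' <= 2 * (Q * M))%N.
  have : (Q <= Q * M)%N by rewrite leq_pmulr.
  by move: MQ2; rewrite mulSn mulnC; lia.
have h2 : (n <= 2 * (S * n'))%N.
  have : (S <= S * n')%N by rewrite leq_pmulr// (leq_trans _ n'Q).
  by rewrite nE mulnC; lia.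
exists M, (n' - 2 * M)%N, r; split => //.
- lia.
- rewrite nE mulnBr [(n' * S)%N]mulnC.
  have : (S * (2 * M) <= S * n')%N by rewrite leq_mul2l orbC; apply/orP; left; lia.
  by rewrite mulnCA; lia.
- split; first by rewrite nE mulnCA [(n' * S)%N]mulnC -[leqLHS]addn0 leq_add// leq_mul// mulnC.
  apply: (leq_trans h2); apply: (@leq_trans (2 * (S * (2 * (Q * M))))).
    by rewrite leq_mul2l leq_mul2l h1 orbT.
  by rewrite leq_eqVlt; apply/orP; left; apply/eqP; ring.
Qed.

Section upper_deviation.
Context (R : realType) (d' : nat) (disp : measure_display)
  (T : measurableType disp) (P : probability T R)
  (t : edge d'.+1 -> {RV P >-> R}).
Hypotheses (d'_gt0 : (0 < d')%N) (t_indep : mutually_independent t)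
  (t_ident : identically_distributed t)
  (t_ge0 : forall e w, 0 <= t e w).
Variables (e0 : edge d'.+1) (h : nat -> R).
Hypotheses (h_ge0 : forall k, 0 <= h k) (h_tail : summable_tail h)
  (h_mgf : forall (k : nat) (s : R), 0 <= s -> s <= (2 ^+ k) ^+ d' ->
    (mgf (t e0) s <= (expR ((2 ^+ k) ^+ d'.+1 * h k))%:E)%E).
Variable (nu : R).
Hypothesis nu_ge0 : 0 <= nu.
Hypothesis nu_lim : {ae P, forall w : T,
     fpp (fun e => t e : T -> R) n w / n%:R @[n --> \oo] --> nu}.

(** If the total over the h' classes exceeds its threshold, one class exceeds its share: a union
    bound over [class_deviation]. *)
Lemma tube_deviation (N L h' A M K1 : nat) (c a b : R) :
  (0 < N)%N -> (0 < h')%N -> (N <= L)%N -> (2 * L < N * h')%N ->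
  (\int[P]_w (expR (block N L c (field t id w) / N%:R))%:E <= (expR a)%:E)%E ->
  (P [set w | (b * (N * h' * (A * M ^ d'))%:R <=
      \sum_(j < h') \sum_(k : 'I_A * {ffun 'I_d' -> 'I_M})
        block_at N L c (site (N * h') (K1 + N * j) k.1 k.2) (field t id w))%R] <=
   (h'%:R * expR ((a - b) * (A * M ^ d')%:R))%:E)%E.
Proof.
move=> N0 h0 NL LS hX.
have N0' : 0 < N%:R :> R by rewrite ltr0n.
pose E j := [set w | (b * (A * M ^ d')%:R <= \sum_(k : 'I_A * {ffun 'I_d' -> 'I_M})
  block_at N L c (site (N * h') (K1 + N * j) k.1 k.2) (field t id w) / N%:R)].
have mblock v : measurable_fun setT (fun w => block_at N L c v (field t id w)).
  apply: (@measurableT_comp _ _ _ _ (cfg R [set: edge d'.+1]) R (block_at N L c v) _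
    (field t id)); [exact: measurable_block_at|exact: measurable_field].
have mge (f : T -> R) x : measurable_fun setT f -> measurable [set w | x <= f w].
  move=> mf; rewrite (_ : [set _ | _] = f @^-1` `[x, +oo[%classic).
    by rewrite -[X in measurable X]setTI; exact: mf.
  by apply/seteqP; split => w /=; rewrite in_itv /= andbT.
have mE j : measurable (E j).
  apply: mge; apply: measurable_sum => k; apply: measurable_funM => //.
apply: (@le_trans _ _ (\sum_(j < h') P (E j))%E).
  apply: (@le_trans _ _ (P (\big[setU/set0]_(j < h') E j))); last exact: Boole_inequality.
  apply: le_measure; rewrite ?inE.
  - by apply: mge; do 2 (apply: measurable_sum => ?); exact: mblock.
  - by apply: bigsetU_measurable => j _.
  move=> w /= hw; rewrite -bigcup_mkord /=; apply: contrapT => hn.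
  move: hw; apply/negP; rewrite -ltNge.
  have -> : b * (N * h' * (A * M ^ d'))%:R = \sum_(j < h') (b * (A * M ^ d')%:R * N%:R).
    by rewrite sumr_const card_ord -[RHS]mulr_natl !natrM; ring.
  apply: ltr_sum; first by apply/hasP; exists (Ordinal h0) => //; rewrite mem_index_enum.
  move=> j _; rewrite -ltr_pdivrMr// mulr_suml ltNge; apply/negP => hj.
  by apply: hn; exists (j : nat) => /=; [exact: ltn_ord|].
apply: (@le_trans _ _ (\sum_(j < h') (expR ((a - b) * (A * M ^ d')%:R))%:E)%E).
  by apply: lee_sum => j _; apply: class_deviation.
by rewrite sumEFin lee_fin sumr_const card_ord mulr_natl.
Qed.

Lemma upper_deviation (eps : R) : 0 < eps ->
  exists C c : R, [/\ 0 < C, 0 < c & exists n0 : nat, forall n, (n0 <= n)%N ->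
    (P [set w | ((nu + eps) * n%:R <= fpp (fun e => t e : T -> R) n w)%R] <=
     (C * expR (- (c * n%:R ^+ d'.+1)))%:E)%E].
Proof.
(* Each ray sum may use eps/4, leaving eps/2 = 3 e1 to the tubes: e1 for the block threshold, e1 for
   its exponential moment, e1 for the rate. *)
move=> eps0; pose e1 := eps / 6.
have e10 : 0 < e1 by rewrite divr_gt0.
have mgf2 : (mgf (t e0) 2 <= (expR ((2 ^+ 1) ^+ d'.+1 * h 1))%:E)%E.
  by apply: h_mgf => //; rewrite expr1 ler_eXnr// ler1n.
have [N [L [N0 NL hX]]] := block_exists t_ident t_ge0 nu_lim e10 mgf2.
(* With 2L + 1 blocks per period, the spacing S = N hh exceeds 2L. *)
pose hh := (2 * L).+1; pose S := (N * hh)%N.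
have S0 : (0 < S)%N by rewrite muln_gt0 N0.
have LS : (2 * L < S)%N by rewrite /S leq_pmull.
pose D : R := (d'.+1 * 2 ^ d' * 2 ^ d'.+1 * 2)%:R.
have D0 : 0 < D by rewrite ltr0n !muln_gt0 !expn_gt0.
pose g : R := eps / 4 / (8 * S%:R) ^+ d'.
have g0 : 0 < g by rewrite divr_gt0 ?exprn_gt0 ?mulr_gt0 ?ltr0n//; lra.
(* The tail is made at most g/(2D), so that the exponent D eta - g of [stair_deviation] equals
   -g/2. *)
have [k0 hk0] := h_tail (divr_gt0 g0 (mulr_gt0 (ltr0Sn R 1) D0)).
(* One factor 2 covers K2 <= 2SM, so 2^k0 K2 <= Q S M <= n; the other ensures Q >= 4, as
   [split_length] requires. *)
pose Q := (2 ^ (k0 + 2))%N.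
have Q0 : (0 < Q)%N by rewrite expn_gt0.
pose W : R := (4 * Q * S)%:R.
have W0 : 0 < W by rewrite ltr0n muln_gt0 S0 muln_gt0 Q0.
(* The rays decay at rate g/2. For the tubes, A M^d' >= M^d >= (n/W)^d gives rate e1/W^d. *)
pose c := Num.min (g / 2) (e1 / W ^+ d'.+1).
have c0 : 0 < c.
  by rewrite lt_min; apply/andP; split; [rewrite divr_gt0|rewrite divr_gt0// exprn_gt0].
exists (2 + hh%:R), c; split => //.
exists (S * Q)%N => n nSQ.
have Q4 : (4 <= Q)%N by rewrite /Q expnD leq_pmull// expn_gt0.
have [M [A [r [M0 MA rS nE2 [nQ nW']]]]] := split_length S0 Q4 nSQ.
have nW : n%:R <= W * M%:R :> R by rewrite /W -natrM ler_nat.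
pose K2 := (S * M + r)%N.
pose E1 := [set w | (M ^ d')%:R * (eps / 4 * n%:R) <=
  stair_sum S (S * M) M (field t id w)].
pose E3 := [set w | (M ^ d')%:R * (eps / 4 * n%:R) <=
  stair_sum S K2 M (field t (refl_edge n) w)].
pose E2 := [set w | ((nu + 3 * e1) * (N * hh * (A * M ^ d'))%:R <=
      \sum_(j < hh) \sum_(k : 'I_A * {ffun 'I_d' -> 'I_M})
        block_at N L ((nu + e1) * N%:R) (site (N * hh) (S * M + N * j) k.1 k.2) (field t id w))].
have mge (f : T -> R) x : measurable_fun setT f -> measurable [set w | x <= f w].
  move=> mf; rewrite (_ : [set _ | _] = f @^-1` `[x, +oo[%classic).
    by rewrite -[X in measurable X]setTI; exact: mf.
  by apply/seteqP; split => w /=; rewrite in_itv /= andbT.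
have mE1 : measurable E1 by apply: mge; exact: measurable_stair_sum.
have mE3 : measurable E3 by apply: mge; exact: measurable_stair_sum.
have mE2 : measurable E2.
  apply: mge; do 2 (apply: measurable_sum => ?).
  apply: (@measurableT_comp _ _ _ _ (cfg R [set: edge d'.+1]) R (block_at N L _ _) _
    (field t id)); [exact: measurable_block_at|exact: measurable_field].
have Md0 : 0 < (M ^ d')%:R :> R by rewrite ltr0n expn_gt0 M0.
have SM0 : (0 < S * M)%N by rewrite muln_gt0 S0.
have SK2 : (S * M <= K2)%N by rewrite leq_addr.
have K2S : (K2 <= 2 * (S * M))%N.
  rewrite /K2 mul2n -addnn leq_add2l; apply: ltnW; apply: (leq_trans rS).
  by rewrite leq_pmulr.
have sub : [set w | (nu + eps) * n%:R <= fpp (fun e => t e : T -> R) n w] `<=`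
    E1 `|` E2 `|` E3.
  move=> w /= hw; apply: contrapT => hn.
  have /negP : ~ E1 w by move=> h1; apply: hn; left; left.
  have /negP : ~ E2 w by move=> h1; apply: hn; left; right.
  have /negP : ~ E3 w by move=> h1; apply: hn; right.
  rewrite -!ltNge => h3 h2 h1.
  have := @route_bound R d' N L hh A M K2 n ((nu + e1) * N%:R) (field t id w)
    (t_ge0 ^~ w) M0 S0 SK2 nE2.
  rewrite -/S => hr.
  have {}hr := le_trans (ler_wpM2l (ltW Md0) hw) hr.
  have h4 : (nu + 3 * e1) * (N * hh * (A * M ^ d'))%:R <= (M ^ d')%:R * ((nu + eps / 2) * n%:R).
    have -> : nu + 3 * e1 = nu + eps / 2 by rewrite /e1; lra.
    have SAn : (S * A)%:R <= n%:R :> R by rewrite ler_nat nE2 addnAC leq_addl.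
    rewrite mulnA natrM [leRHS]mulrCA ler_wpM2l//; first by rewrite addr_ge0// divr_ge0// ltW.
    by rewrite [leRHS]mulrC ler_wpM2r ?(ltW Md0).
  move: hr h1 h2 h3.
  set Y2 := \sum_(b < hh) _; set Y1 := stair_sum S (S * M) M _.
  set Y3 := stair_sum S K2 M _ => hr h1 h2 h3; move: hr; apply/negP; rewrite -ltNge.
  have := ltrD (ltrD h1 (lt_le_trans h2 h4)) h3.
  by congr (_ < _); field.
have n2k0 : (2 ^ k0 * K2 <= n)%N.
  apply: leq_trans nQ; rewrite /Q expnD -mulnA leq_mul2l; apply/orP; right.
  by apply: (leq_trans K2S); rewrite leq_mul2r orbT.
have n2k0' : (2 ^ k0 * (S * M) <= n)%N.
  by apply: leq_trans n2k0; rewrite leq_mul2l SK2 orbT.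
have expg : n%:R ^+ d'.+1 * (D * (g / (2 * D)) - g) <= - (c * n%:R ^+ d'.+1) :> R.
  have aux (x y : R) : 0 < x -> x * (y / (2 * x)) - y = - (y / 2).
    by move=> x0; field; rewrite gt_eqF.
  rewrite aux// mulrN lerN2 mulrC ler_wpM2l// ?exprn_ge0//.
  by rewrite /c ge_min lexx.
have eps4 : 0 < eps / 4 by rewrite divr_gt0.
have P1 : (P E1 <= (expR (- (c * n%:R ^+ d'.+1)))%:E)%E.
  have id_inj : injective (id : edge d'.+1 -> edge d'.+1) by [].
  apply: (le_trans (stair_deviation t_indep t_ident h_ge0 h_mgf id_inj S0 M0 (leqnn _) _ n2k0' eps4 hk0)).
    by rewrite mul2n -addnn leq_addr.
  by rewrite lee_fin ler_expR.
have P3 : (P E3 <= (expR (- (c * n%:R ^+ d'.+1)))%:E)%E.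
  have r_inj := inv_inj (@refl_edgeK d' n).
  apply: (le_trans (stair_deviation t_indep t_ident h_ge0 h_mgf r_inj S0 M0 SK2 K2S n2k0 eps4 hk0)).
  by rewrite lee_fin ler_expR.
have P2 : (P E2 <= (hh%:R * expR (- (c * n%:R ^+ d'.+1)))%:E)%E.
  apply: (le_trans (@tube_deviation N L hh A M (S * M) ((nu + e1) * N%:R) (nu + 2 * e1)
    (nu + 3 * e1) N0 (ltn0Sn _) NL LS hX)).
  rewrite lee_fin ler_wpM2l// ler_expR.
  have -> : nu + 2 * e1 - (nu + 3 * e1) = - e1 by ring.
  rewrite mulNr lerN2.
  apply: (@le_trans _ _ (e1 / W ^+ d'.+1 * (W * M%:R) ^+ d'.+1)).
    apply: ler_pM; rewrite ?exprn_ge0//; first exact: ltW.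
      by rewrite /c ge_min lexx orbT.
    by rewrite ler_pXn2r ?nnegrE// mulr_ge0// ltW.
  rewrite exprMn mulrA divfK ?gt_eqF ?exprn_gt0// ler_wpM2l ?(ltW e10)//.
  by rewrite -natrX ler_nat expnS leq_mul2r MA orbT.
apply: (@le_trans _ _ (P (E1 `|` E2 `|` E3))).
  apply: le_measure; rewrite ?inE//; first exact: measurable_fpp_ge.
  by apply: measurableU => //; exact: measurableU.
have mE12 : measurable (E1 `|` E2) by exact: measurableU.
apply: (le_trans (measureU2 P mE12 mE3)).
apply: (@le_trans _ _ ((expR (- (c * n%:R ^+ d'.+1)))%:E +
  (hh%:R * expR (- (c * n%:R ^+ d'.+1)))%:E + (expR (- (c * n%:R ^+ d'.+1)))%:E)%E).
  by apply: leeD => //; apply: (le_trans (measureU2 P mE1 mE2)); exact: leeD.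
by rewrite -!EFinD lee_fin; lra.
Qed.

End upper_deviation.

(** * Barriers *)

Section crossing.
Context (R : realType) (d : nat).
Implicit Types (x y : 'rV[int]_d) (e : edge d).

Definition nrm x : nat := (\max_(i < d) absz (x ord0 i))%N.

Definition far e : 'rV[int]_d := e.1 + delta_mx ord0 e.2.

(* An edge crossing from norm r to norm r.+1 has [rad] equal to r.+1. *)
Definition rad e : nat := maxn (nrm e.1) (nrm (far e)).

Lemma nrm0 : nrm 0 = 0%N.
Proof. by apply/eqP; rewrite -leqn0; apply/bigmax_leqP => i _; rewrite mxE. Qed.

Lemma nrm_axis n : (0 < d)%N -> nrm (axis_point d n) = n.
Proof.
move=> d0; apply/eqP; rewrite eqn_leq; apply/andP; split.
  by apply/bigmax_leqP => i _; rewrite mxE; case: ifP.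
apply: leq_trans (@leq_bigmax _ (fun i => absz (axis_point d n ord0 i)) (Ordinal d0)).
by rewrite mxE.
Qed.

Lemma nrm_adj x y : adj x y -> (nrm y <= (nrm x).+1)%N.
Proof.
move=> /eqP xy; apply/bigmax_leqP => i _.
have hi : `|x ord0 i - y ord0 i| <= 1.
  by rewrite -xy (bigD1 i) //= lerDl sumr_ge0.
have := @leq_bigmax _ (fun i => absz (x ord0 i)) i.
rewrite -/(nrm x) => h; lia.
Qed.

Lemma rad_joins e x y : joins e x y -> rad e = maxn (nrm x) (nrm y).
Proof. by move=> /orP[] /andP[/eqP -> /eqP ->]; rewrite /rad// maxnC. Qed.

Lemma crossing x p r : path (@adj d) x p -> (nrm x <= r)%N -> (r < nrm (last x p))%N ->
  exists2 e, trav x p e & rad e = r.+1.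
Proof.
elim: p x => [|y p IH] x /=; first by move=> _ h1 h2; move: (leq_trans h2 h1); rewrite ltnn.
move=> /andP[xy py] xr rl; have [yr|ry] := leqP (nrm y) r.
  have [e te re] := IH y py yr rl; exists e => //.
  by rewrite trav_cons; right.
have /adj_joinsP [e je] := xy; exists e; first by rewrite trav_cons; left.
rewrite (rad_joins je); have := nrm_adj xy; lia.
Qed.

(** The path crosses every sphere below radius n', and crossing edges with different [rad] are
    distinct, so their costs add up. *)
Lemma passage_lower (u : edge d -> R) (p : seq 'rV[int]_d) (n n' : nat) (X : nat -> R) :
  (0 < d)%N -> (forall e, 0 <= u e) -> fpp_path n p -> (n' <= n.+1)%N ->
  (forall e, (0 < rad e < n')%N -> X (rad e) <= u e) ->
  \sum_(1 <= r < n') X r <= pcost u 0 p.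
Proof.
move=> d0 u0 /andP[pp /eqP lp] n'n hX.
have ex r : exists e, (1 <= r < n')%N -> trav 0 p e /\ rad e = r.
  case: (boolP (1 <= r < n')%N) => [/andP[r1 rn]|_]; last by exists (0, Ordinal d0).
  have [||e te re] := @crossing 0 p r.-1 pp.
  - by rewrite nrm0.
  - by rewrite lp nrm_axis// prednK// -ltnS (leq_trans rn).
  by exists e => _; split => //; rewrite re prednK.
have [E hE] := choice ex.
rewrite /pcost fsbig_finite; last exact: finite_trav.
apply: (@le_trans _ _ (\sum_(e <- [seq E r | r <- index_iota 1 n']) u e)).
  rewrite big_map big_seq [leRHS]big_seq; apply: ler_sum => r.
  rewrite mem_index_iota => rn; have [te re] := hE r rn.
  by have := hX (E r); rewrite re; apply.
apply: ler_sum_uniq_sub => //.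
  rewrite map_inj_in_uniq ?iota_uniq// => r r'; rewrite !mem_index_iota => rn r'n /(congr1 rad).
  by rewrite (hE r rn).2 (hE r' r'n).2.
move=> e /mapP [r]; rewrite mem_index_iota => rn ->.
by rewrite in_fset_set; [exact/mem_set/(hE r rn).1|exact: finite_trav].
Qed.

Definition box_seq (B : nat) : seq (edge d) :=
  [seq (\row_i ((fi.1 i)%:Z - B%:Z), fi.2) | fi : {ffun 'I_d -> 'I_(2 * B).+1} * 'I_d].

Lemma mem_box_seq B e : (nrm e.1 <= B)%N -> e \in box_seq B.
Proof.
case: e => x i /= xB; apply/fintype.imageP.
have hx k : (absz (x ord0 k) <= B)%N.
  exact: leq_trans (@leq_bigmax _ (fun i => absz (x ord0 i)) k) xB.
exists ([ffun k => inord (absz (x ord0 k + B%:Z))], i) => //=; congr pair.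
apply/rowP => k; rewrite mxE ffunE inordK; last by have := hx k; lia.
change (x ord0 k = Posz (absz (x ord0 k + B%:Z)) - B%:Z); have := hx k; lia.
Qed.

Lemma size_box_seq B : size (box_seq B) = ((2 * B).+1 ^ d * d)%N.
Proof. by rewrite size_image card_prod card_ffun !card_ord. Qed.

Definition ball (B : nat) : {fset edge d} :=
  [fset e in box_seq B | (0 < rad e < B)%N]%fset.

Lemma mem_ball B e : (e \in ball B) = (0 < rad e < B)%N.
Proof.
rewrite !inE /=; apply/andP/idP => [[]//|h]; split => //.
by apply: mem_box_seq; move: h; rewrite /rad; lia.
Qed.

(** Edges with [rad] in the dyadic shell of index k have their base point in a box of side 2^(k+2) +
    1 <= 8 2^k. *)
Lemma sum_ball (K : nat) (Z : nat -> R) : (forall k, 0 <= Z k) ->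
  \sum_(e <- ball (2 ^ K)) Z (trunc_log 2 (rad e)) <=
  \sum_(k < K) (8 ^ d * d)%:R * (2 ^+ k) ^+ d * Z k.
Proof.
move=> Z0.
have tlK e : e \in ball (2 ^ K) -> (trunc_log 2 (rad e) < K)%N.
  rewrite mem_ball => /andP[r0 rK]; rewrite -(@ltn_exp2l 2)//.
  by apply: leq_ltn_trans rK; have /andP[] := @trunc_log_bounds 2 _ isT r0.
have -> : \sum_(e <- ball (2 ^ K)) Z (trunc_log 2 (rad e)) =
    \sum_(k < K) \sum_(e <- ball (2 ^ K)) (trunc_log 2 (rad e) == k)%:R * Z k.
  rewrite exchange_big /= big_seq [RHS]big_seq; apply: eq_bigr => e eb.
  rewrite (bigD1 (Ordinal (tlK e eb))) //= eqxx mul1r big1 ?addr0// => k ke.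
  case: eqP => [h|_]; last by rewrite mul0r.
  by move: ke; rewrite -val_eqE /= h eqxx.
apply: ler_sum => k _; rewrite -mulr_suml ler_wpM2r// -natr_sum -natrX -natrX -natrM ler_nat.
rewrite (eq_bigr (fun e => if trunc_log 2 (rad e) == k then 1 else 0)%N); last first.
  by move=> e _; case: eqP.
rewrite -big_mkcond sum1_count -size_filter.
apply: (@leq_trans (size (box_seq (2 ^ k.+1)))).
  apply: uniq_leq_size; first by rewrite filter_uniq// fset_uniq.
  move=> e; rewrite mem_filter mem_ball => /andP[/eqP ke /andP[r0 _]].
  apply: mem_box_seq; apply: (@leq_trans (rad e)); first exact: leq_maxl.
  by have /andP[_ /ltnW] := @trunc_log_bounds 2 _ isT r0; rewrite ke.
rewrite size_box_seq mulnAC leq_mul2r -expnMn; apply/orP; right.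
have [->|d0] := posnP d; first by [].
rewrite leq_exp2r// expnS; have : (0 < 2 ^ k)%N by rewrite expn_gt0.
lia.
Qed.

End crossing.

Lemma sum_trunc_log (R : realType) (X : nat -> R) K :
  \sum_(1 <= r < 2 ^ K) X (trunc_log 2 r) = \sum_(k < K) 2 ^+ k * X k.
Proof.
elim: K => [|K IH]; first by rewrite big_ord0 big_geq.
have p0 : (0 < 2 ^ K)%N by rewrite expn_gt0.
rewrite (@big_cat_nat _ _ _ (2 ^ K)%N)//=; last by rewrite leq_exp2l.
rewrite IH big_ord_recr /=; congr (_ + _).
rewrite (eq_big_nat _ _ (F2 := fun=> X K)); last first.
  by move=> r /andP[r1 r2]; congr X; apply: trunc_log_eq => //; rewrite r1.
by rewrite sumr_const_nat expnS mul2n -addnn addnK -natrX mulr_natl.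
Qed.

Section lower_deviation.
Context (R : realType) (d' : nat) (disp : measure_display)
  (T : measurableType disp) (P : probability T R)
  (t : edge d'.+1 -> {RV P >-> R}) (M0 : R) (f : R -> R).
Hypotheses (d'_gt0 : (0 < d')%N) (t_indep : mutually_independent t)
  (t_ge0 : forall e w, 0 <= t e w) (M0_gt0 : 0 < M0)
  (f_gt0 : forall x : R, 0 < x -> 0 < f x)
  (f_incr : forall x y : R, 0 < x -> x <= y -> f x <= f y)
  (tail : forall e (x : R), M0 < x ->
     P [set w | x < t e w] = (expR (- (ln 2 * (x ^+ d'.+1 * f x))))%:E).

Definition barrier (K : nat) (X : nat -> R) : set T :=
  \bigcap_(e in [set` ball d'.+1 (2 ^ K)]) (t e @^-1` [set x | X (trunc_log 2 (rad e)) < x]).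

Lemma barrier_prob (K : nat) (X : nat -> R) : (forall k, M0 < X k) ->
  P (barrier K X) = (expR (- (ln 2 *
    \sum_(e <- ball d'.+1 (2 ^ K)) (X (trunc_log 2 (rad e)) ^+ d'.+1 * f (X (trunc_log 2 (rad e)))))))%:E.
Proof.
move=> hX; rewrite /barrier.
rewrite (t_indep (ball d'.+1 (2 ^ K))
  (B := fun e => [set x | X (trunc_log 2 (rad e)) < x])); last first.
  move=> e; rewrite (_ : [set _ | _] = `]X (trunc_log 2 (rad e)), +oo[%classic)//.
  by apply/seteqP; split=> x /=; rewrite in_itv /= andbT.
rewrite (eq_bigr (fun e => (expR (- (ln 2 * (X (trunc_log 2 (rad e)) ^+ d'.+1 *
  f (X (trunc_log 2 (rad e)))))))%:E)); last by move=> e _; exact: tail.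
by rewrite prodEFin -expR_sum mulr_sumr sumrN.
Qed.

Lemma barrier_fpp (K n : nat) (X : nat -> R) w : (2 ^ K <= n.+1)%N ->
  barrier K X w ->
  \sum_(k < K) 2 ^+ k * X k <= fpp (fun e => t e : T -> R) n w.
Proof.
move=> Kn hw; apply: fpp_ge => [|p pp]; first exact: (exists_fpp_path R).
rewrite -sum_trunc_log.
apply: (@passage_lower R d'.+1 (fun e => t e w) p n (2 ^ K) (fun r => X (trunc_log 2 r))) => //.
by move=> e re; apply/ltW/hw; rewrite /= mem_ball.
Qed.

Lemma measurable_barrier K X : measurable (barrier K X).
Proof.
apply: fin_bigcap_measurable => // e _.
rewrite -[X in measurable X]setTI; apply: measurable_funP => //.
rewrite (_ : [set _ | _] = `]X (trunc_log 2 (rad e)), +oo[%classic)//.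
by apply/seteqP; split=> x /=; rewrite in_itv /= andbT.
Qed.

Local Notation G j := (f (2 ^+ j) `^ (d'%:R)^-1)^-1.

(** Take n = 2^mu and barrier heights c 2^(mu-k) g(mu-k), where c = C/Sm normalises the total
    crossing cost to C n. The energy is then at most of order n^d C^d / Sm^d', plus the contribution
    of the floor M1, which is small because the barrier stops at radius n 2^-q0. *)
Lemma lower_deviation (C delta : R) (n0 : nat) : 0 < C -> 0 < delta ->
  (forall q (B : R), exists m : nat, B <= \sum_(q <= j < m) G j) ->
  exists n, [/\ (n0 <= n)%N, (0 < n)%N &
    ((expR (- (ln 2 * (delta * n%:R ^+ d'.+1))))%:E <=
    P [set w | (C * n%:R <= fpp (fun e => t e : T -> R) n w)%R])%E].
Proof.
move=> C0 delta0 hdiv; set g := fun j : nat => G j.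
have pow0 j : 0 < 2 ^+ j :> R by rewrite exprn_gt0.
have g0 j : 0 < g j by rewrite invr_gt0 powR_gt0// f_gt0.
have gE j : g j ^+ d' * f (2 ^+ j) = 1.
  have fj := f_gt0 (pow0 j).
  rewrite /g exprVn -(powR_mulrn d' (powR_ge0 _ _)) -powRrM mulVf ?pnatr_eq0 -?lt0n//.
  by rewrite powRr1 ?mulVf ?gt_eqF// ltW.
have gmax j : g j <= g 0%N.
  rewrite /g lef_pV2 ?posrE ?powR_gt0 ?f_gt0//.
  apply: ge0_ler_powR; rewrite ?nnegrE ?invr_ge0// ?(ltW (f_gt0 _))//.
  by apply: f_incr => //; rewrite expr0 exprn_ege1// ler1n.
pose M1 := M0 + 1.
have M10 : 0 < M1 by rewrite addr_gt0.
pose Zc := M1 ^+ d'.+1 * f M1.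
have Zc0 : 0 < Zc by rewrite mulr_gt0 ?exprn_gt0 ?f_gt0.
pose D : R := (8 ^ d'.+1 * d'.+1)%:R.
have D0 : 0 < D by rewrite ltr0n muln_gt0 expn_gt0.
(* Stopping q scales before n makes the part of the energy due to the floor M1 at most (delta/2)
   n^d. Taking q0 >= n0 also forces n >= n0. *)
have [q hq] := archi_pow2 (D * Zc / (delta / 2)) ltr01.
pose q0 := maxn q n0.
(* The three summands give Sm >= 1, c g(j) <= 1, and the bound delta/2 on the main energy. The sum
   starts at q0 + 1, the least value of mu - k for k < K. *)
have [m] := hdiv q0.+1 (1 + C * g 0%N + D * C ^+ d'.+1 / (delta / 2)).
set Sm := \sum_(_ <= j < _) _ => hm.
have DC0 : 0 < D * C ^+ d'.+1 / (delta / 2) by rewrite divr_gt0 ?divr_gt0 ?mulr_gt0 ?exprn_gt0.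
have Cg0 : 0 < C * g 0%N by rewrite mulr_gt0.
have Sm1 : 1 <= Sm by lra.
have Sm0 : 0 < Sm by lra.
have [qm|mq] := ltnP q0.+1 m; last first.
  by move: Sm0; rewrite /Sm big_geq// ltxx.
pose mu := m.-1; have mE : m = mu.+1 by rewrite prednK// (leq_trans _ qm).
have q0mu : (q0 <= mu)%N by apply: ltnW; rewrite -ltnS -mE.
pose K := (mu - q0)%N; have KE : mu = (K + q0)%N by rewrite subnK.
pose n := (2 ^ mu)%N.
have nR : n%:R = 2 ^+ mu :> R by rewrite natrX.
pose c := C / Sm; have c0 : 0 < c by rewrite divr_gt0.
have cg j : c * g j <= 1.
  rewrite /c mulrAC ler_pdivrMr// mul1r; apply: (@le_trans _ _ (C * g 0%N)); last lra.
  by rewrite ler_wpM2l// ltW.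
pose v k := c * (2 ^+ (mu - k) * g (mu - k)%N).
have v0 k : 0 < v k by rewrite mulr_gt0// mulr_gt0.
(* The tail formula holds only above M0, hence the floor M1 = M0 + 1. *)
pose X k := Num.max M1 (v k).
have XM k : M0 < X k by rewrite lt_max ltrDl ltr01.
have X0 k : 0 < X k by exact: lt_trans (XM k).
have SmE : Sm = \sum_(k < K) g (mu - k)%N.
  rewrite /Sm mE big_nat_rev /= -{1}[q0.+1]add0n big_addn subSS -/K big_mkord.
  by apply: eq_bigr => k _; congr g; rewrite addnC -addSn subnDr subSS.
have gain : C * n%:R <= \sum_(k < K) 2 ^+ k * X k.
  apply: (@le_trans _ _ (\sum_(k < K) c * n%:R * g (mu - k)%N)).
    by rewrite -mulr_sumr -SmE /c mulrAC divfK ?gt_eqF.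
  apply: ler_sum => k _; apply: (@le_trans _ _ (2 ^+ k * v k)); last first.
    by rewrite ler_wpM2l ?(ltW (pow0 _))// /X le_max lexx orbT.
  have kmu : (k <= mu)%N by exact: leq_trans (ltnW (ltn_ord k)) (leq_subr _ _).
  rewrite nR -{1}(subnKC kmu) exprD /v.
  by rewrite le_eqVlt; apply/orP; left; apply/eqP; ring.
pose Z k := X k ^+ d'.+1 * f (X k).
have Z0 k : 0 <= Z k by rewrite mulr_ge0 ?exprn_ge0 ?ltW ?f_gt0.
have Zle k : Z k <= Zc + c ^+ d'.+1 * (2 ^+ (mu - k)) ^+ d'.+1 * g (mu - k)%N.
  have h0 : 0 <= c ^+ d'.+1 * (2 ^+ (mu - k)) ^+ d'.+1 * g (mu - k)%N.
    by rewrite !mulr_ge0 ?exprn_ge0// ltW.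
  have h1 : v k ^+ d'.+1 * f (v k) <= c ^+ d'.+1 * (2 ^+ (mu - k)) ^+ d'.+1 * g (mu - k)%N.
    (* From c g <= 1, v k is at most 2^(mu-k); monotonicity then reaches the value of [f] that
       defines g(mu-k). *)
    have fv : f (v k) <= f (2 ^+ (mu - k)).
      apply: f_incr => //; rewrite /v mulrCA ler_piMr// ltW//.
    apply: (le_trans (ler_wpM2l _ fv)); first by rewrite exprn_ge0 ?ltW.
    have aux (a p x y : R) : (a * (p * x)) ^+ d'.+1 * y =
        a ^+ d'.+1 * p ^+ d'.+1 * x * (x ^+ d' * y).
      by rewrite !exprMn [x ^+ d'.+1]exprS !mulrA.
    by rewrite aux gE mulr1.
  rewrite /Z /X; case: (leP M1 (v k)) => _.
    by apply: (le_trans h1); rewrite lerDr ltW.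
  by rewrite lerDl.
have geo k : \sum_(i < k) (2 ^+ i) ^+ d'.+1 <= (2 ^+ k) ^+ d'.+1 :> R.
  elim: k => [|k IH]; first by rewrite big_ord0 exprn_ge0.
  rewrite big_ord_recr /=; apply: (@le_trans _ _ (2 * (2 ^+ k) ^+ d'.+1)).
    by rewrite mulr_natl mulr2n lerD2r.
  rewrite [2 ^+ k.+1]exprS exprMn ler_wpM2r ?exprn_ge0//.
  by rewrite ler_eXnr// ler1n.
have cost : \sum_(e <- ball d'.+1 (2 ^ K)) Z (trunc_log 2 (rad e)) <= delta * n%:R ^+ d'.+1.
  apply: (le_trans (sum_ball d'.+1 K Z0)).
  apply: (@le_trans _ _ (\sum_(k < K) (D * Zc * (2 ^+ k) ^+ d'.+1 +
      D * c ^+ d'.+1 * n%:R ^+ d'.+1 * g (mu - k)%N))).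
    apply: ler_sum => k _; have kmu : (k <= mu)%N by exact: leq_trans (ltnW (ltn_ord k)) (leq_subr _ _).
    apply: (le_trans (ler_wpM2l _ (Zle k))); first by rewrite mulr_ge0 ?exprn_ge0.
    have -> : n%:R ^+ d'.+1 = (2 ^+ k) ^+ d'.+1 * (2 ^+ (mu - k)) ^+ d'.+1 :> R.
      by rewrite nR -exprMn -exprD subnKC.
    rewrite -/D; move: ((2 ^+ k) ^+ d'.+1) ((2 ^+ (mu - k)) ^+ d'.+1) (c ^+ d'.+1) => x y z.
    by rewrite le_eqVlt; apply/orP; left; apply/eqP; ring.
  rewrite big_split /= -mulr_sumr -mulr_sumr -SmE [delta]splitr mulrDl; apply: lerD.
    apply: (@le_trans _ _ (D * Zc * (2 ^+ K) ^+ d'.+1)).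
      by apply: ler_wpM2l; [rewrite mulr_ge0// ltW|exact: geo].
    rewrite nR KE exprD exprMn [leRHS]mulrCA [leLHS]mulrC ler_wpM2l ?exprn_ge0//.
    move: hq; rewrite mulr1 ler_pdivrMr ?divr_gt0// => /le_trans; apply.
    have d2 : 0 <= delta / 2 by rewrite divr_ge0// ltW.
    rewrite [leLHS]mulrC ler_wpM2l//.
    apply: (@le_trans _ _ (2 ^+ q0)); first by rewrite ler_weXn2l ?ler1n// leq_maxl.
    by rewrite ler_eXnr// exprn_ege1// ler1n.
  rewrite -mulrA [_ * Sm]mulrC mulrA ler_wpM2r ?exprn_ge0//.
  (* After the normalisation, Sm^d' >= Sm remains in the denominator, as Sm >= 1 and d' > 0;
     divergence of the series makes this as large as required. *)
  have -> : D * c ^+ d'.+1 * Sm = D * C ^+ d'.+1 / Sm ^+ d'.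
    rewrite -!mulrA; congr (_ * _).
    by rewrite /c expr_div_n [Sm ^+ d'.+1]exprSr invfM mulrA divfK ?gt_eqF.
  rewrite ler_pdivrMr ?exprn_gt0// -ler_pdivrMl ?divr_gt0// mulrC.
  apply: (@le_trans _ _ Sm); first lra.
  by rewrite ler_eXnr.
exists n; split.
- apply: (@leq_trans mu); last by rewrite ltnW// ltn_expl.
  by rewrite KE; apply: leq_trans (leq_addl _ _); exact: leq_maxr.
- by rewrite expn_gt0.
apply: (@le_trans _ _ (P (barrier K X))).
  rewrite barrier_prob// lee_fin ler_expR lerN2 ler_wpM2l//.
  by rewrite ln_ge0// ler1n.
apply: le_measure; rewrite ?inE.
- exact: measurable_barrier.
- exact: measurable_fpp_ge.
move=> w hw /=; apply: (le_trans gain); apply: barrier_fpp => //.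
by rewrite leqW// leq_exp2l// leq_subr.
Qed.

End lower_deviation.

(** * The equivalence *)

Lemma log2e_le (R : realType) (p : \bar R) (a : R) :
  (0 <= p)%E -> (p <= (expR a)%:E)%E -> (log2e p <= (a / ln 2)%:E)%E.
Proof.
have l2 : 0 < ln 2 :> R by rewrite ln_gt0// ltr1n.
move=> p0 pa; rewrite /log2e EFinM lee_wpmul2r ?lee_fin ?invr_ge0 ?(ltW l2)//.
rewrite -[a]expRK -lne_EFin ?expR_gt0// lee_lne//; rewrite in_itv/= leey andbT//.
Qed.

Lemma log2e_ge (R : realType) (p : \bar R) (a : R) :
  ((expR a)%:E <= p)%E -> ((a / ln 2)%:E <= log2e p)%E.
Proof.
have l2 : 0 < ln 2 :> R by rewrite ln_gt0// ltr1n.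
move=> pa; rewrite /log2e EFinM lee_wpmul2r ?lee_fin ?invr_ge0 ?(ltW l2)//.
rewrite -[a]expRK -lne_EFin ?expR_gt0// lee_lne//; rewrite in_itv/= leey andbT ?lee_fin ?expR_ge0//.
by apply: le_trans pa; rewrite lee_fin expR_ge0.
Qed.

Lemma log2e_inj (R : realType) (p : \bar R) (a : R) : p \is a fin_num ->
  log2e p = (- a)%:E -> p = (expR (- (ln 2 * a)))%:E.
Proof.
have l2 : 0 < ln 2 :> R by rewrite ln_gt0// ltr1n.
case: p => [r _||]//; rewrite /log2e; case: (leP r 0) => r0.
  by rewrite /lne r0 mulNyr gtr0_sg ?invr_gt0// mul1e.
rewrite lne_EFin// -EFinM => -[h]; congr EFin.
by rewrite -(lnK (x := r)) ?posrE// -[ln r](mulfVK (lt0r_neq0 l2)) h mulrC mulrN.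
Qed.

Lemma partial_sums_unbounded (R : realType) (u : nat -> R) :
  (forall n, 0 <= u n) -> ~ (\sum_(1 <= n <oo) (u n)%:E < +oo)%E ->
  forall q (B : R), exists m : nat, B <= \sum_(q <= j < m) u j.
Proof.
move=> u0 hdiv q B; apply: contrapT => hn; apply: hdiv.
apply: (@le_lt_trans _ _ (\sum_(0 <= j < q) u j + B)%:E); last exact: ltry.
apply: lime_le; first by apply: is_cvg_nneseries => n _ _; rewrite lee_fin.
apply: nearW => m; rewrite sumEFin lee_fin.
apply: (@le_trans _ _ (\sum_(0 <= j < maxn q m) u j)).
  case: m => [|m]; first by rewrite big_geq// sumr_ge0.
  rewrite (@big_cat_nat _ _ _ 1 0 (maxn q m.+1))//=; last by rewrite leq_max orbT.
  rewrite (@big_cat_nat _ _ _ m.+1 1 (maxn q m.+1))//=; last by rewrite leq_maxr.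
  by rewrite addrCA lerDl addr_ge0 ?sumr_ge0.
rewrite (@big_cat_nat _ _ _ q)//= ?leq_maxl// lerD2l.
by apply/ltW; rewrite ltNge; apply/negP => h; apply: hn; exists (maxn q m).
Qed.

Lemma limn_esup_lt0 (R : realType) (u : (\bar R)^nat) (a : R) (n0 : nat) : 0 < a ->
  (forall n, (n0 <= n)%N -> (u n <= (- a)%:E)%E) -> (limn_esup u < 0)%E.
Proof.
move=> a0 hu; apply: (@le_lt_trans _ _ (- a)%:E); last by rewrite lte_fin oppr_lt0.
apply: (@le_trans _ _ (ereal_sup (u @` [set n | (n0 <= n)%N]))).
  by apply: ereal_inf_lbound; exists [set n | (n0 <= n)%N] => //; exists n0.
by apply: ge_ereal_sup => _ [n /= hn <-]; exact: hu.
Qed.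

Lemma limn_esup_ge0 (R : realType) (u : (\bar R)^nat) :
  (forall (e : R) (n0 : nat), 0 < e -> exists2 n, (n0 <= n)%N & ((- e)%:E <= u n)%E) ->
  (0 <= limn_esup u)%E.
Proof.
move=> hu; apply: le_ereal_inf_tmp => _ [V [n0 _ hV] <-].
apply/lee_addgt0Pr => e e0; have [n hn un] := hu e n0 e0.
have : ((- e)%:E <= ereal_sup (u @` V))%E.
  by apply: le_trans un _; apply: ereal_sup_ubound; exists n => //; exact: hV.
by move=> /(leeD2r e%:E); rewrite -EFinD addNr.
Qed.

Theorem theorem1p3 (R : realType) (disp : measure_display)
  (T : measurableType disp) (P : probability T R)
  (d : nat) (hd : (2 <= d)%N)
  (t : edge d -> {RV P >-> R})
  (t_indep : mutually_independent t)
  (t_ident : identically_distributed t)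
  (t_ge0 : forall (e : edge d) (w : T), 0 <= t e w)
  (M0 : R) (hM0 : 0 < M0)
  (f : R -> R)
  (f_gt0 : forall x : R, 0 < x -> 0 < f x)
  (f_incr : forall x y : R, 0 < x -> x <= y -> f x <= f y)
  (t_tail : forall (e : edge d) (x : R), M0 < x ->
     log2e (P [set w | x < t e w]) = (- (x ^+ d * f x))%:E)
  (nu : R) (nu_ge0 : 0 <= nu)
  (nu_lim : {ae P, forall w : T,
     fpp (fun e => t e : T -> R) n w / n%:R @[n --> \oo] --> nu}) :
  exists2 eps0 : R, 0 < eps0 &
    forall eps : R, 0 < eps -> eps < eps0 ->
      (limn_esup (fun n : nat =>
         ((n%:R ^+ d)^-1)%:E *
         log2e (P [set w | ((nu + eps) * n%:R <= fpp (fun e => t e : T -> R) n w)%R]))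
         < 0)%E
      <->
      (\sum_(1 <= n <oo) ((f (2 ^+ n) `^ (d%:R - 1)^-1)^-1)%:E < +oo)%E.
Proof.
case: d hd t t_indep t_ident t_ge0 t_tail nu_lim => // d' hd' t' ti tid t0 ttail hlim.
have d'0 : (0 < d')%N by [].
have l2 : 0 < ln 2 :> R by rewrite ln_gt0// ltr1n.
have tail e x : M0 < x ->
    P [set w | x < t' e w] = (expR (- (ln 2 * (x ^+ d'.+1 * f x))))%:E.
  move=> Mx; apply: log2e_inj; last exact: ttail.
  apply: fin_num_measure.
  rewrite (_ : [set _ | _] = t' e @^-1` `]x, +oo[%classic).
    by rewrite -[X in measurable X]setTI; exact: measurable_funP.
  by apply/seteqP; split => w /=; rewrite in_itv /= andbT.
exists 1 => // eps eps0 _.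
have dE : (d'.+1)%:R - 1 = d'%:R :> R by rewrite -natr1 addrK.
rewrite dE; pose G j := (f (2 ^+ j) `^ (d'%:R)^-1)^-1.
have G0 j : 0 <= G j by rewrite invr_ge0 powR_ge0.
split => [hsup|hsum].
  (* By contraposition: if the series diverges, [lower_deviation] at level nu + eps gives
     arbitrarily large n with normalised logarithm at least -e, so the limsup is nonnegative. *)
  apply: contrapT => hdiv; move: hsup; apply/negP; rewrite -leNgt.
  apply: limn_esup_ge0 => e n0 e0.
  have C0 : 0 < nu + eps by rewrite ltr_wpDl.
  have [n [n0n n_gt0 hn]] := @lower_deviation R d' disp T P t' M0 f d'0 ti t0 hM0 f_gt0
    f_incr tail (nu + eps) e n0 C0 e0 (partial_sums_unbounded G0 hdiv).
  exists n => //; have := log2e_ge hn.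
  have nd0 : 0 < n%:R ^+ d'.+1 :> R by rewrite exprn_gt0// ltr0n.
  have i0 : (0 <= ((n%:R ^+ d'.+1)^-1 : R)%:E)%E by rewrite lee_fin invr_ge0 ltW.
  move=> /(lee_wpmul2l i0); apply: le_trans.
  rewrite -EFinM lee_fin le_eqVlt; apply/orP; left; apply/eqP.
  by field; rewrite !gt_eqF.
have htail : summable_tail G by exact: summable_tail_eseries.
have [h [h0 hs hm]] := mgf_summable (P := P) (Y := t' (0, ord0)) (t0 _) hM0 f_gt0 f_incr
  (tail (0, ord0)) d'0 htail.
have [C [c [C0 c0 [n0 hn]]]] := @upper_deviation R d' disp T P t' d'0 ti tid t0 (0, ord0) h
  h0 hs hm nu nu_ge0 hlim eps eps0.
(* Beyond this n the prefactor satisfies ln C <= (c/2) n^d, leaving the rate c/2; [n0.+1] also makes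
   n positive. *)
pose n1 := maxn n0.+1 (Num.bound (`|ln C| / (c / 2))).
apply: (@limn_esup_lt0 R _ (c / 2 / ln 2) n1); first by rewrite !divr_gt0.
move=> n n1n.
have n0n : (n0 <= n)%N by apply: leq_trans n1n; apply: leq_trans (leq_maxl _ _).
have n_gt0 : (0 < n)%N by apply: leq_trans n1n; apply: leq_trans (leq_maxl _ _).
have nd0 : 0 < n%:R ^+ d'.+1 :> R by rewrite exprn_gt0// ltr0n.
have i0 : (0 <= ((n%:R ^+ d'.+1)^-1 : R)%:E)%E by rewrite lee_fin invr_ge0 ltW.
have lC : ln C <= c / 2 * n%:R ^+ d'.+1.
  apply: (le_trans (ler_norm _)); rewrite mulrC -ler_pdivrMr ?divr_gt0//.
  apply: (@le_trans _ _ n%:R); last first.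
    by rewrite -natrX ler_nat -[leqLHS]expn1 leq_pexp2l.
  apply: (le_trans (ltW (archi_boundP _))); first by rewrite divr_ge0// divr_ge0// ltW.
  by rewrite ler_nat; apply: leq_trans n1n; exact: leq_maxr.
have hP : (P [set w | ((nu + eps) * n%:R <= fpp (fun e => t' e : T -> R) n w)%R] <=
    (expR (ln C - c * n%:R ^+ d'.+1))%:E)%E.
  by rewrite expRD lnK ?posrE//; exact: hn.
have := log2e_le (measure_ge0 _ _) hP => /(lee_wpmul2l i0) /le_trans; apply.
rewrite -EFinM lee_fin mulrA -[leRHS]mulNr ler_pM2r ?invr_gt0// ler_pdivrMl//.
move: (ln C) (n%:R ^+ d'.+1) lC => x y; lra.
Qed.
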